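(* Let $(X,d)$ be a Cantor space. If $f\in\mathcal{H}(X)$ is topologically stable in the strong sense, then $f$ has the shadowing property and the non-wandering set $\Omega(f)$ is finite.
   Context: A Cantor space is a compact metric space without isolated points that is totally disconnected. $\mathcal{H}(X)$ is the set of homeomorphisms; $d_{C^0}(f,g)=\sup_x d(f(x),g(x))$; $D(f,g)=\max\{d_{C^0}(f,g),d_{C^0}(f^{-1},g^{-1})\}$. $f$ is topologically stable in the strong sense if for every $\epsilon>0$ there is $\delta>0$ such that for every $g\in\mathcal{H}(X)$ with $D(f,g)<\delta$ there is a surjective continuous $h:X\to X$ with $d_{C^0}(h,\mathrm{id}_X)<\epsilon$ and $h\circ g=f\circ h$. $f$ has the shadowing property if for every $\epsilon>0$ there is $\delta>0$ such that every sequence $(x_i)_{i\ge0}$ with $d(f(x_i),x_{i+1})\le\delta$ for all $i$ admits $x\in X$ with $d(x_i,f^i(x))\le\epsilon$ for all $i\ge0$. $\Omega(f)$ is the set of $x$ such that for every neighborhood $U$ of $x$ there is $n>0$ with $f^n(U)\cap U\neq\emptyset$. *)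

(* Defs.v *)
From Stdlib Require Import Reals List.
Open Scope R_scope.

Section MetricDefs.
Context {X : Type} (d : X -> X -> R).

Definition is_metric : Prop :=
  (forall x y, 0 <= d x y) /\
  (forall x y, d x y = 0 <-> x = y) /\
  (forall x y, d x y = d y x) /\
  (forall x y z, d x z <= d x y + d y z).

Definition open (U : X -> Prop) : Prop :=
  forall x, U x -> exists r, 0 < r /\ forall y, d x y < r -> U y.

Definition compact : Prop :=
  forall (I : Type) (U : I -> X -> Prop),
    (forall i, open (U i)) -> (forall x, exists i, U i x) ->
    exists l : list I, forall x, exists i, In i l /\ U i x.

Definition no_isolated_points : Prop :=
  forall x eps, 0 < eps -> exists y, y <> x /\ d x y < eps.

Definition connected (S : X -> Prop) : Prop :=
  forall U V, open U -> open V ->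
    (forall x, S x -> U x \/ V x) ->
    (forall x, ~ (S x /\ U x /\ V x)) ->
    (forall x, S x -> U x) \/ (forall x, S x -> V x).

Definition totally_disconnected : Prop :=
  forall S, connected S -> forall x y, S x -> S y -> x = y.

Definition cantor_space : Prop :=
  is_metric /\ compact /\ no_isolated_points /\ totally_disconnected.

Definition continuous (f : X -> X) : Prop :=
  forall x eps, 0 < eps -> exists delta, 0 < delta /\
    forall y, d x y < delta -> d (f x) (f y) < eps.

Definition is_homeo (f finv : X -> X) : Prop :=
  continuous f /\ continuous finv /\
  (forall x, finv (f x) = x) /\ (forall x, f (finv x) = x).

Definition dC0_lt (f g : X -> X) (e : R) : Prop :=
  exists s, is_lub (fun r => exists x, r = d (f x) (g x)) s /\ s < e.

(* D(f,g) < e, where D(f,g) = max(d_{C^0}(f,g), d_{C^0}(f^{-1},g^{-1})) *)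
Definition D_lt (f finv g ginv : X -> X) (e : R) : Prop :=
  dC0_lt f g e /\ dC0_lt finv ginv e.

Definition topologically_stable_strong (f finv : X -> X) : Prop :=
  forall eps, 0 < eps -> exists delta, 0 < delta /\
    forall g ginv, is_homeo g ginv -> D_lt f finv g ginv delta ->
      exists h : X -> X, continuous h /\ (forall y, exists x, h x = y) /\
        dC0_lt h (fun x => x) eps /\
        (forall x, h (g x) = f (h x)).

Definition shadowing (f : X -> X) : Prop :=
  forall eps, 0 < eps -> exists delta, 0 < delta /\
    forall xs : nat -> X, (forall i, d (f (xs i)) (xs (S i)) <= delta) ->
      exists x, forall i, d (xs i) (Nat.iter i f x) <= eps.

Definition nonwandering (f : X -> X) (x : X) : Prop :=
  forall U, open U -> U x ->
    exists n, (0 < n)%nat /\ exists y, U y /\ U (Nat.iter n f y).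

Definition finite_set (P : X -> Prop) : Prop :=
  exists l : list X, forall x, P x -> In x l.

End MetricDefs.

(* Main.v *)
(* Coding X by binary sequences (Brouwer), a clopen partition turns f into a finite graph
   with an edge a -> b when f maps a point of a into b, and every homeomorphism g moving
   points along edges is D-close to f.

   Shadowing: a finite pseudo-orbit can be made injective by changing tails, and it is then
   a genuine orbit of g = u o f, where u is a product of local exchanges of nearby points.
   The semiconjugacy h carries that orbit to a shadowing f-orbit; compactness handles
   infinite pseudo-orbits.

   Finiteness: choose a successor s(a) and a predecessor p(a) of each cell a, and split
   each cell by a sign. There is g following edges which contracts the positive half along s
   and whose inverse contracts the negative half along p, so every forward g-orbit
   accumulates on a finite set P of periodic points. As h is onto, every forward f-orbit
   accumulates on h(P). A non-wandering point is almost on a periodic pseudo-orbit; the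
   orbit shadowing it accumulates on h(P), so the point lies in h(P). *)
From Stdlib Require Import Reals List Lra Lia Arith Cantor FinFun.
From Stdlib Require Import ClassicalEpsilon FunctionalExtensionality.
Require Import Defs.

Local Open Scope nat_scope.

(** * Binary sequences *)

Definition bits : Type := nat -> bool.

Definition agree (n : nat) (x y : bits) : Prop := forall i, i < n -> x i = y i.

Definition bcontinuous (f : bits -> bits) : Prop :=
  forall x n, exists m, forall y, agree m x y -> agree n (f x) (f y).

Definition buniform (f : bits -> bits) : Prop :=
  forall n, exists m, forall x y, agree m x y -> agree n (f x) (f y).

Definition bhomeo (f g : bits -> bits) : Prop :=
  bcontinuous f /\ bcontinuous g /\
  (forall x, g (f x) = x) /\ (forall x, f (g x) = x).

Lemma agree_refl n x : agree n x x.
Proof. intros i _; reflexivity. Qed.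

Lemma agree_sym n x y : agree n x y -> agree n y x.
Proof. intros H i Hi; symmetry; auto. Qed.

Lemma agree_trans n x y z : agree n x y -> agree n y z -> agree n x z.
Proof. intros H1 H2 i Hi; rewrite H1, H2; auto. Qed.

Lemma agree_le m n x y : m <= n -> agree n x y -> agree m x y.
Proof. intros Hmn H i Hi; apply H; lia. Qed.

Lemma agree_all x y : (forall n, agree n x y) -> x = y.
Proof. intros H; apply functional_extensionality; intros i; apply (H (S i)); lia. Qed.

Lemma not_agree x y : x <> y -> exists n, ~ agree n x y.
Proof.
  intros H. apply not_all_ex_not. intros Hn. apply H, agree_all, Hn.
Qed.

Lemma bcontinuous_comp f g :
  bcontinuous f -> bcontinuous g -> bcontinuous (fun x => f (g x)).
Proof.
  intros Hf Hg x n. destruct (Hf (g x) n) as [m Hm].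
  destruct (Hg x m) as [k Hk]. exists k; auto.
Qed.

Lemma buniform_bcontinuous f : buniform f -> bcontinuous f.
Proof. intros H x n. destruct (H n) as [m Hm]. exists m; auto. Qed.

Lemma bhomeo_comp f f' g g' :
  bhomeo f f' -> bhomeo g g' -> bhomeo (fun x => f (g x)) (fun x => g' (f' x)).
Proof.
  intros (H1 & H2 & H3 & H4) (K1 & K2 & K3 & K4). repeat split.
  - now apply bcontinuous_comp.
  - now apply bcontinuous_comp.
  - intros x. now rewrite H3.
  - intros x. now rewrite K4.
Qed.

(** There are at most [2^n] prefixes of length [n]; the induction splits [Q] by the last bit of the
    prefix. *)
Lemma finite_of_agree (n : nat) (Q : bits -> Prop) :
  (forall x y, Q x -> Q y -> agree n x y -> x = y) ->
  exists l : list bits, forall x, Q x -> In x l.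
Proof.
  revert Q. induction n as [|n IH]; intros Q HQ.
  - destruct (excluded_middle_informative (exists x, Q x)) as [[x Hx]|Hno].
    + exists (x :: nil). intros y Hy. left. apply HQ; auto. intros i Hi; lia.
    + exists nil. intros y Hy. apply Hno; eauto.
  - assert (Hb : forall b, exists l : list bits, forall x, Q x /\ x n = b -> In x l).
    { intros b. apply IH. intros x y [Qx Ex] [Qy Ey] Hxy. apply HQ; auto.
      intros i Hi. destruct (Nat.eq_dec i n) as [->|]; [congruence|apply Hxy; lia]. }
    destruct (Hb true) as [l1 H1], (Hb false) as [l2 H2].
    exists (l1 ++ l2). intros x Hx. apply in_or_app.
    destruct (x n) eqn:E; auto.
Qed.

(** * Finite pseudo-orbits are orbits of perturbations *)

(* Translation by [r xor q] near [r] and [q] exchanges the two cylinders of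
   length [M] and in particular the points themselves. *)
Definition local_swap (M : nat) (r q x : bits) : bits :=
  if excluded_middle_informative (agree M r x \/ agree M q x)
  then fun i => xorb (x i) (xorb (r i) (q i)) else x.

Lemma local_swap_near M r q x y :
  agree M x y ->
  (local_swap M r q x = fun i => xorb (x i) (xorb (r i) (q i))) /\
  (local_swap M r q y = fun i => xorb (y i) (xorb (r i) (q i))) \/
  local_swap M r q x = x /\ local_swap M r q y = y.
Proof.
  intros H. unfold local_swap.
  destruct (excluded_middle_informative _) as [Hx|Hx],
    (excluded_middle_informative _) as [Hy|Hy]; auto; exfalso.
  - apply Hy. destruct Hx; [left|right]; eapply agree_trans; eauto.
  - apply Hx. apply agree_sym in H. destruct Hy; [left|right]; eapply agree_trans; eauto.
Qed.

Lemma local_swap_continuous M r q : bcontinuous (local_swap M r q).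
Proof.
  intros x n. exists (max M n). intros y Hy.
  assert (Hn : agree n x y) by (apply agree_le with (2 := Hy); lia).
  destruct (local_swap_near M r q x y) as [[-> ->]|[-> ->]]; auto.
  - apply agree_le with (2 := Hy); lia.
  - intros i Hi. now rewrite Hn.
Qed.

Lemma local_swap_involutive M r q x : local_swap M r q (local_swap M r q x) = x.
Proof.
  unfold local_swap at 2.
  destruct (excluded_middle_informative _) as [H|H].
  - unfold local_swap. destruct (excluded_middle_informative _) as [K|K].
    + apply functional_extensionality; intros i.
      now destruct (x i), (r i), (q i).
    + exfalso. apply K. destruct H as [H|H]; [right|left]; intros i Hi;
        specialize (H i Hi); rewrite <- H; now destruct (r i), (q i).
  - unfold local_swap. now destruct (excluded_middle_informative _).
Qed.

Lemma local_swap_agree m M r q x : agree m r q -> agree m x (local_swap M r q x).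
Proof.
  intros H i Hi. unfold local_swap.
  destruct (excluded_middle_informative _); auto.
  rewrite H by auto. now destruct (x i), (q i).
Qed.

Lemma local_swap_left M r q : local_swap M r q r = q.
Proof.
  unfold local_swap. destruct (excluded_middle_informative _) as [_|H].
  - apply functional_extensionality; intros i. now destruct (r i), (q i).
  - exfalso. apply H. left. apply agree_refl.
Qed.

Lemma local_swap_far M r q x :
  ~ agree M r x -> ~ agree M q x -> local_swap M r q x = x.
Proof.
  intros H1 H2. unfold local_swap.
  now destruct (excluded_middle_informative _) as [[|]|].
Qed.

Lemma separating_level (N : nat) (q : nat -> bits) (r : bits) :
  (forall i, i < N -> q i <> r) ->
  exists M, forall i, i < N -> ~ agree M r (q i).
Proof.
  induction N as [|N IH]; intros H.
  - exists 0. intros i Hi; lia.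
  - destruct IH as [M HM]; [intros; apply H; lia|].
    destruct (not_agree r (q N)) as [K HK]; [intros E; apply (H N); auto|].
    exists (max M K). intros i Hi Ha.
    destruct (Nat.eq_dec i N) as [->|].
    + apply HK. apply agree_le with (2 := Ha); lia.
    + apply (HM i); [lia|]. apply agree_le with (2 := Ha); lia.
Qed.

(** The points are placed one at a time: the map [u] for the first [N] points is followed by a local
    swap of [u (p N)] with [q N]. Both differ from every earlier [q i], so long enough cylinders
    leave these fixed. *)
Lemma move_points (m N : nat) (p q : nat -> bits) :
  (forall i j, i < j < N -> p i <> p j) ->
  (forall i j, i < j < N -> q i <> q j) ->
  (forall i, i < N -> agree m (p i) (q i)) ->
  exists u v, bhomeo u v /\ (forall x, agree m x (u x)) /\
    forall i, i < N -> u (p i) = q i.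
Proof.
  induction N as [|N IH]; intros Hp Hq Hpq.
  - exists (fun x => x), (fun x => x). repeat split; auto using agree_refl; try lia.
    + intros x n; exists n; auto.
    + intros x n; exists n; auto.
  - destruct IH as (u & v & Huv & Hu & Hup).
    { intros; apply Hp; lia. }
    { intros; apply Hq; lia. }
    { intros; apply Hpq; lia. }
    destruct (separating_level N q (u (p N))) as [M1 HM1].
    { intros i Hi E. rewrite <- Hup in E by auto.
      apply (f_equal v) in E. destruct Huv as (_ & _ & Hvu & _).
      rewrite !Hvu in E. apply (Hp i N); auto; lia. }
    destruct (separating_level N q (q N)) as [M2 HM2].
    { intros i Hi. apply Hq; lia. }
    set (t := local_swap (max M1 M2) (u (p N)) (q N)).
    assert (Hr : agree m (u (p N)) (q N)).
    { eapply agree_trans; [apply agree_sym, Hu|apply Hpq; lia]. }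
    exists (fun x => t (u x)), (fun x => v (t x)). repeat split.
    + apply bcontinuous_comp; [apply local_swap_continuous|apply Huv].
    + apply bcontinuous_comp; [apply Huv|apply local_swap_continuous].
    + intros x. unfold t. rewrite local_swap_involutive. apply Huv.
    + intros x. destruct Huv as (_ & _ & _ & ->). apply local_swap_involutive.
    + intros x. eapply agree_trans; [apply Hu|]. now apply local_swap_agree.
    + intros i Hi. destruct (Nat.eq_dec i N) as [->|].
      * apply local_swap_left.
      * rewrite Hup by lia. apply local_swap_far; intros Ha.
        -- apply (HM1 i); [lia|]. apply agree_le with (2 := Ha); lia.
        -- apply (HM2 i); [lia|]. apply agree_le with (2 := Ha); lia.
Qed.

Lemma realize_pseudo_orbit (F F' : bits -> bits) :
  buniform F -> buniform F' -> (forall x, F' (F x) = x) -> (forall x, F (F' x) = x) ->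
  forall n, exists m, forall N (xs : nat -> bits),
    (forall i, i < N -> agree m (F (xs i)) (xs (S i))) ->
    exists g g', bhomeo g g' /\ (forall x, agree n (F x) (g x)) /\
      (forall x, agree n (F' x) (g' x)) /\
      exists x, forall i, i <= N -> agree n (xs i) (Nat.iter i g x).
Proof.
  intros HF HF' HFl HFr n.
  (* Level [m0] is fine enough for [F'] to control the inverse perturbation too. Level [m1] lets [F]
     carry the change of tails over to level [m0]. *)
  destruct (HF' n) as [m0' Hm0']. set (m0 := max n m0').
  destruct (HF m0) as [m1' Hm1']. set (m1 := max m0 m1').
  exists m1. intros N xs Hxs.
  (* Writing the index into the tail makes the points pairwise distinct. *)
  set (ys := fun i k => if k <? m1 then xs i k else k =? m1 + i).
  assert (Hys : forall i, agree m1 (xs i) (ys i)).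
  { intros i k Hk. unfold ys. apply Nat.ltb_lt in Hk. now rewrite Hk. }
  assert (Hd : forall i j, i < j -> ys i <> ys j).
  { intros i j Hij E. apply (f_equal (fun y => y (m1 + i))) in E. unfold ys in E.
    replace (m1 + i <? m1) with false in E by (symmetry; apply Nat.ltb_ge; lia).
    rewrite Nat.eqb_refl in E. symmetry in E. apply Nat.eqb_eq in E. lia. }
  destruct (move_points m0 N (fun i => F (ys i)) (fun i => ys (S i)))
    as (u & v & Huv & Hu & Hup).
  { intros i j Hij E. apply (f_equal F') in E. rewrite !HFl in E.
    apply (Hd i j); auto; lia. }
  { intros i j Hij. apply Hd; lia. }
  { intros i Hi. apply agree_trans with (F (xs i)).
    - apply Hm1'. apply agree_sym. apply agree_le with (2 := Hys i). lia.
    - apply agree_trans with (xs (S i)).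
      + apply agree_le with (2 := Hxs i Hi). lia.
      + apply agree_le with (2 := Hys (S i)). lia. }
  exists (fun x => u (F x)), (fun x => F' (v x)). split; [|split; [|split]].
  - apply bhomeo_comp; auto. repeat split; auto using buniform_bcontinuous.
  - intros x. apply agree_le with (2 := Hu (F x)). lia.
  - intros x. apply Hm0'. apply agree_sym.
    destruct Huv as (_ & _ & _ & Hr). rewrite <- (Hr x) at 2.
    apply agree_le with (2 := Hu (v x)). lia.
  - exists (ys 0). intros i Hi.
    replace (Nat.iter i (fun x => u (F x)) (ys 0)) with (ys i).
    + apply agree_le with (2 := Hys i). lia.
    + induction i as [|i IH]; simpl; auto. rewrite <- IH by lia.
      symmetry; apply Hup; lia.
Qed.

(** * Clopen sets of binary sequences *)

Definition bcons (b : bool) (x : bits) : bits :=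
  fun i => match i with 0 => b | S i => x i end.

Definition btail (x : bits) : bits := fun i => x (S i).

Lemma bcons_tail x : bcons (x 0) (btail x) = x.
Proof. apply functional_extensionality; intros [|i]; reflexivity. Qed.

Lemma bcons_agree n b x y : agree n x y -> agree (S n) (bcons b x) (bcons b y).
Proof. intros H [|i] Hi; simpl; auto. apply H; lia. Qed.

Lemma btail_agree n x y : agree (S n) x y -> agree n (btail x) (btail y).
Proof. intros H i Hi. apply H; lia. Qed.

Lemma bcons_continuous b f : bcontinuous f -> bcontinuous (fun x => bcons b (f x)).
Proof.
  intros Hf x n. destruct (Hf x n) as [m Hm]. exists m. intros y Hy.
  apply agree_le with (S n); [lia|]. apply bcons_agree; auto.
Qed.

Lemma btail_continuous f : bcontinuous f -> bcontinuous (fun x => f (btail x)).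
Proof.
  intros Hf x n. destruct (Hf (btail x) n) as [m Hm]. exists (S m). intros y Hy.
  apply Hm, btail_agree, Hy.
Qed.

(** A nonempty clopen set is a copy of the whole space. If both values of the first bit occur in
    [A], the halves are parametrized separately and glued along that bit; otherwise the constant bit
    is dropped. *)
Lemma clopen_parametrization (n : nat) (A : bits -> Prop) :
  (forall x y, agree n x y -> A x -> A y) -> (exists x, A x) ->
  exists u v, bcontinuous u /\ bcontinuous v /\ (forall x, A (v x)) /\
    (forall x, u (v x) = x) /\ (forall x, A x -> v (u x) = x).
Proof.
  revert A. induction n as [|n IH]; intros A HA [x0 Hx0].
  - exists (fun x => x), (fun x => x). repeat split; auto.
    + intros x n; exists n; auto.
    + intros x n; exists n; auto.
    + intros x. apply (HA x0); auto. intros i Hi; lia.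
  - assert (HAb : forall b, (exists x, A (bcons b x)) ->
      exists u v, bcontinuous u /\ bcontinuous v /\ (forall x, A (bcons b (v x))) /\
        (forall x, u (v x) = x) /\ (forall x, A (bcons b x) -> v (u x) = x)).
    { intros b Hb. apply (IH (fun x => A (bcons b x))); auto.
      intros x y Hxy. apply HA. now apply bcons_agree. }
    destruct (excluded_middle_informative (forall b, exists x, A (bcons b x))) as [Hall|Hsome].
    + destruct (HAb true (Hall true)) as (u1 & v1 & Cu1 & Cv1 & Av1 & L1 & R1).
      destruct (HAb false (Hall false)) as (u0 & v0 & Cu0 & Cv0 & Av0 & L0 & R0).
      (* The first bit is locally constant, so gluing along it preserves continuity. *)
      assert (Hc : forall f1 f0, bcontinuous f1 -> bcontinuous f0 ->
        bcontinuous (fun x => bcons (x 0) (if x 0 then f1 (btail x) else f0 (btail x)))).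
      { intros f1 f0 H1 H0 x k.
        destruct (bcons_continuous (x 0) _ (btail_continuous _ H1) x k) as [m1 Hm1].
        destruct (bcons_continuous (x 0) _ (btail_continuous _ H0) x k) as [m0 Hm0].
        exists (S (max m0 m1)). intros y Hy.
        rewrite <- (Hy 0) by lia.
        destruct (x 0); [apply Hm1|apply Hm0]; apply agree_le with (2 := Hy); lia. }
      exists (fun x => bcons (x 0) (if x 0 then u1 (btail x) else u0 (btail x))),
        (fun x => bcons (x 0) (if x 0 then v1 (btail x) else v0 (btail x))).
      repeat split; auto.
      * intros x. destruct (x 0); auto.
      * intros x.
        change (bcons (x 0) (if x 0 then u1 (if x 0 then v1 (btail x) else v0 (btail x))
          else u0 (if x 0 then v1 (btail x) else v0 (btail x))) = x).
        etransitivity; [|apply bcons_tail]. destruct (x 0); f_equal; auto.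
      * intros x Hx. rewrite <- (bcons_tail x) in Hx.
        change (bcons (x 0) (if x 0 then v1 (if x 0 then u1 (btail x) else u0 (btail x))
          else v0 (if x 0 then u1 (btail x) else u0 (btail x))) = x).
        etransitivity; [|apply bcons_tail]. destruct (x 0); f_equal; auto.
    + assert (Hb : exists b, forall x, A x -> x 0 = b).
      { apply not_all_ex_not in Hsome. destruct Hsome as [b Hb]. exists (negb b).
        intros x Hx. destruct (Bool.bool_dec (x 0) b) as [E|E].
        - exfalso. apply Hb. exists (btail x). rewrite <- E, bcons_tail. exact Hx.
        - now destruct (x 0), b. }
      destruct Hb as [b Hb].
      destruct (HAb b) as (u & v & Cu & Cv & Av & L & R).
      { exists (btail x0). now rewrite <- (Hb x0 Hx0), bcons_tail. }
      exists (fun x => u (btail x)), (fun x => bcons b (v x)). repeat split; auto.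
      * now apply btail_continuous.
      * now apply bcons_continuous.
      * intros x Hx. rewrite <- (bcons_tail x) at 2. rewrite (Hb x Hx). f_equal.
        apply R. now rewrite <- (Hb x Hx), bcons_tail.
Qed.

Lemma clopen_homeo (n : nat) (A B : bits -> Prop) :
  (forall x y, agree n x y -> A x -> A y) -> (exists x, A x) ->
  (forall x y, agree n x y -> B x -> B y) -> (exists x, B x) ->
  exists u v, bcontinuous u /\ bcontinuous v /\
    (forall x, A x -> B (u x) /\ v (u x) = x) /\
    (forall x, B x -> A (v x) /\ u (v x) = x).
Proof.
  intros HA EA HB EB.
  destruct (clopen_parametrization n A HA EA) as (a & a' & Ca & Ca' & Aa & La & Ra).
  destruct (clopen_parametrization n B HB EB) as (b & b' & Cb & Cb' & Ab & Lb & Rb).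
  exists (fun x => b' (a x)), (fun x => a' (b x)). repeat split; auto.
  - now apply bcontinuous_comp.
  - now apply bcontinuous_comp.
  - rewrite Lb; auto.
  - rewrite La; auto.
Qed.

(** * Stacks of blocks *)

(* The sequence [a_0 ... a_(m-1) b y_0 y_1 ...]: a block of [m] letters and a sign
   is pushed onto [y]. *)
Definition push (m : nat) (a : bits) (b : bool) (y : bits) : bits :=
  fun i => if i <? m then a i else if i =? m then b else y (i - S m).

Definition pop (m : nat) (x : bits) : bits := fun i => x (S m + i).

Lemma push_prefix m a b y : agree m a (push m a b y).
Proof. intros i Hi. unfold push. apply Nat.ltb_lt in Hi. now rewrite Hi. Qed.

Lemma push_sign m a b y : push m a b y m = b.
Proof. unfold push. now rewrite Nat.ltb_irrefl, Nat.eqb_refl. Qed.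

Lemma pop_push m a b y : pop m (push m a b y) = y.
Proof.
  apply functional_extensionality; intros i. unfold pop, push.
  destruct (Nat.ltb_spec (S m + i) m); [lia|].
  destruct (Nat.eqb_spec (S m + i) m); [lia|]. f_equal; lia.
Qed.

Lemma push_pop m a x : agree m a x -> push m a (x m) (pop m x) = x.
Proof.
  intros H. apply functional_extensionality; intros i. unfold pop, push.
  destruct (Nat.ltb_spec i m); [auto|].
  destruct (Nat.eqb_spec i m); [congruence|]. f_equal; lia.
Qed.

Lemma push_agree m n a a' b y y' :
  agree m a a' -> agree n y y' -> agree (S m + n) (push m a b y) (push m a' b y').
Proof.
  intros Ha Hy i Hi. unfold push.
  destruct (Nat.ltb_spec i m); [auto|].
  destruct (Nat.eqb_spec i m); [auto|]. apply Hy; lia.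
Qed.

Lemma push_eq m a a' b y : agree m a a' -> push m a b y = push m a' b y.
Proof.
  intros Ha. apply agree_all. intros n. apply agree_le with (S m + n); [lia|].
  apply push_agree; auto using agree_refl.
Qed.

Lemma pop_agree m n x y : agree (S m + n) x y -> agree n (pop m x) (pop m y).
Proof. intros H i Hi. apply H; lia. Qed.

(** * Contraction by pushing blocks *)

Section Contraction.
Context (m : nat) (q : bits -> bits) (sg : bool) (G : bits -> bits).
Context (q_agree : forall x y, agree m x y -> agree m (q x) (q y)).
Context (G_push : forall x, x m = sg -> G x = push m (q x) sg x).

Lemma iter_sign j x : x m = sg -> Nat.iter j G x m = sg.
Proof.
  intros H. induction j as [|j IH]; simpl; auto.
  rewrite G_push by auto. apply push_sign.
Qed.

Lemma iter_agree_cell j x y : x m = sg -> y m = sg ->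
  agree m x y -> agree m (Nat.iter j G x) (Nat.iter j G y).
Proof.
  intros Hx Hy H. induction j as [|j IH]; simpl; auto.
  rewrite !G_push by auto using iter_sign.
  eapply agree_trans; [apply agree_sym, push_prefix|].
  eapply agree_trans; [|apply push_prefix]. auto.
Qed.

(** Each step puts [m + 1] letters determined by the cell on top and moves the earlier agreement
    deeper. *)
Lemma iter_contract j x y : x m = sg -> y m = sg ->
  agree m x y -> agree j (Nat.iter j G x) (Nat.iter j G y).
Proof.
  intros Hx Hy H. induction j as [|j IH]; simpl.
  - intros i Hi; lia.
  - rewrite !G_push by auto using iter_sign.
    apply agree_le with (S m + j); [lia|].
    apply push_agree; auto using iter_agree_cell.
Qed.

(** Each cell holds at most one such point: two of them return to themselves after [n * T] steps,
    while contraction makes them agree to any depth. *)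
Lemma periodic_finite T : 0 < T -> exists l : list bits,
  forall x, x m = sg /\ Nat.iter T G x = x -> In x l.
Proof.
  intros HT. apply finite_of_agree with m.
  intros x y [Sx Ex] [Sy Ey] Hxy. apply agree_all. intros n.
  assert (Hfix : forall z, Nat.iter T G z = z -> Nat.iter (n * T) G z = z).
  { intros z Hz. induction n as [|n IH]; simpl; auto. now rewrite Nat.iter_add, IH. }
  rewrite <- (Hfix x), <- (Hfix y) by auto.
  apply agree_le with (n * T); [nia|]. now apply iter_contract.
Qed.

Definition cell_periodic (i d : nat) (x : bits) : Prop :=
  forall j, i <= j -> agree m (Nat.iter (j + d) G x) (Nat.iter j G x).

Lemma cell_periodic_mul i i' d k x : i <= i' ->
  cell_periodic i d x -> cell_periodic i' (d * k) x.
Proof.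
  intros Hi H. induction k as [|k IH]; intros j Hj.
  - rewrite Nat.mul_0_r, Nat.add_0_r. apply agree_refl.
  - replace (j + d * S k) with (j + d * k + d) by lia.
    eapply agree_trans; [apply H; lia|]. apply IH; lia.
Qed.

(** A chosen point in each cell, so that a finite list of points can stand for all cells of sign
    [sg]. *)
Definition cell_repr (x : bits) : bits := push m x sg (fun _ => false).

Lemma cell_reprs : exists l : list bits, forall x, In (cell_repr x) l.
Proof.
  destruct (finite_of_agree m (fun w => exists x, w = cell_repr x)) as [l Hl].
  - intros x y [a ->] [b ->] H. apply push_eq.
    eapply agree_trans; [apply push_prefix|].
    eapply agree_trans; [apply H|]. apply agree_sym, push_prefix.
  - exists l. eauto.
Qed.

(** Pigeonhole: some cell is visited twice, and the itinerary repeats from there because the next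
    cell depends only on the present one. *)
Lemma cell_periodic_point x : x m = sg -> exists i d, 0 < d /\ cell_periodic i d x.
Proof.
  intros Sx. destruct cell_reprs as [l Hl].
  assert (H : exists i j, i < j /\ agree m (Nat.iter i G x) (Nat.iter j G x)).
  { apply NNPP. intros Hno.
    assert (Hinj : Injective (fun j => cell_repr (Nat.iter j G x))).
    { intros i j E.
      assert (Ha : agree m (Nat.iter i G x) (Nat.iter j G x)).
      { cbv beta in E. apply agree_trans with (cell_repr (Nat.iter i G x)).
        - apply push_prefix.
        - rewrite E. apply agree_sym, push_prefix. }
      destruct (Nat.lt_trichotomy i j) as [|[|]]; auto; exfalso; apply Hno.
      - exists i, j; auto.
      - exists j, i; auto using agree_sym. }
    apply Injective_map_NoDup with (l := seq 0 (S (length l))) in Hinj; [|apply seq_NoDup].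
    apply NoDup_incl_length with (l' := l) in Hinj.
    - rewrite length_map, length_seq in Hinj. lia.
    - intros w Hw. apply in_map_iff in Hw. destruct Hw as (j & <- & _). apply Hl. }
  destruct H as (i & j & Hij & Ha). exists i, (j - i). split; [lia|].
  intros k Hk.
  replace (k + (j - i)) with ((k - i) + j) by lia.
  replace (Nat.iter k G x) with (Nat.iter ((k - i) + i) G x) by (f_equal; lia).
  rewrite !Nat.iter_add. apply iter_agree_cell; auto using iter_sign, agree_sym.
Qed.

Lemma cell_periodic_uniform :
  exists T, 0 < T /\ forall x, x m = sg -> cell_periodic T T x.
Proof.
  destruct cell_reprs as [l Hl].
  assert (H : exists i d, 0 < d /\ forall x, In x l -> x m = sg -> cell_periodic i d x).
  { clear Hl. induction l as [|x l IH].
    - exists 0, 1. split; [lia|]. intros x [].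
    - destruct IH as (i & d & Hd & IH).
      destruct (excluded_middle_informative (x m = sg)) as [Sx|Sx].
      + destruct (cell_periodic_point x Sx) as (i' & d' & Hd' & Hx).
        exists (max i i'), (d * d'). split; [nia|].
        intros y [<-|Hy] Sy.
        * rewrite Nat.mul_comm. apply cell_periodic_mul with i'; auto; lia.
        * apply cell_periodic_mul with i; auto; lia.
      + exists i, d. split; auto. intros y [<-|Hy] Sy; [contradiction|auto]. }
  (* A multiple of the period [d] that is at least [i] serves both as period and as preperiod. *)
  destruct H as (i & d & Hd & H). exists (d * S i). split; [nia|].
  intros x Sx. apply cell_periodic_mul with i; [nia|].
  assert (Hr : agree m x (cell_repr x)) by apply push_prefix.
  assert (Sr : cell_repr x m = sg) by apply push_sign.
  intros j Hj. eapply agree_trans; [apply iter_agree_cell; eauto|].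
  eapply agree_trans; [apply (H _ (Hl x) Sr); auto|].
  apply agree_sym, iter_agree_cell; auto.
Qed.

(** The top of the stack records the cells visited last. From time [T + n] on, the top [n] blocks
    come from the periodic part of the itinerary. *)
Lemma cell_periodic_contract T x : x m = sg -> cell_periodic T T x ->
  forall n j, T + n <= j -> agree n (Nat.iter (j + T) G x) (Nat.iter j G x).
Proof.
  intros Sx H. induction n as [|n IH]; intros j Hj.
  - intros i Hi; lia.
  - destruct j as [|j]; [lia|].
    assert (Hm : agree m (Nat.iter (j + T) G x) (Nat.iter j G x)) by (apply H; lia).
    simpl. rewrite !G_push by auto using iter_sign.
    apply agree_le with (S m + n); [lia|].
    apply push_agree; auto. apply IH; lia.
Qed.

(** The points at times [j + k * T] form a Cauchy sequence, and its limit [w] is fixed by [T] steps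
    because [G] is continuous on the sign [sg]. *)
Lemma approaches_periodic T x : 0 < T -> x m = sg -> cell_periodic T T x ->
  forall n j, T + n <= j ->
    exists w, w m = sg /\ Nat.iter T G w = w /\ agree n w (Nat.iter j G x).
Proof.
  intros HT Sx HP n j Hj.
  set (y := fun k => Nat.iter (j + k * T) G x).
  assert (Hstep : forall i k k', i <= T * k + n -> k <= k' -> agree i (y k') (y k)).
  { intros i k k' Hi Hk. induction Hk as [|k' Hk IH]; [apply agree_refl|].
    eapply agree_trans; [|apply IH]. unfold y.
    replace (j + S k' * T) with (j + k' * T + T) by lia.
    apply cell_periodic_contract; auto. nia. }
  (* As [T] is positive, letter [i] no longer changes from [y (S i)] on. *)
  set (w := fun i => y (S i) i).
  assert (Hw : forall i k, i <= T * k + n -> agree i w (y k)).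
  { intros i k Hi r Hr. unfold w.
    destruct (Nat.le_ge_cases (S r) k).
    - symmetry. apply (Hstep (S r)); auto; nia.
    - apply (Hstep i); auto; nia. }
  assert (Sw : w m = sg).
  { rewrite (Hw (S m) (S m)) by nia. now apply iter_sign. }
  exists w. split; [auto|split].
  - apply agree_all. intros i. set (k := i + S m).
    assert (Ha : forall r, agree (i + S m) (Nat.iter r G w) (Nat.iter r G (y k))).
    { induction r as [|r IH]; simpl; [apply Hw; nia|].
      rewrite !G_push by (auto using iter_sign; apply iter_sign, iter_sign, Sx).
      apply agree_le with (S m + (i + S m)); [lia|]. apply push_agree; auto.
      apply q_agree. apply agree_le with (2 := IH). lia. }
    apply agree_trans with (y (S k)).
    + replace (y (S k)) with (Nat.iter T G (y k)).
      * apply agree_le with (2 := Ha T). lia.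
      * unfold y. rewrite <- Nat.iter_add. f_equal. lia.
    + apply agree_sym, Hw. nia.
  - replace (Nat.iter j G x) with (y 0).
    + apply Hw. lia.
    + unfold y. f_equal. lia.
Qed.

End Contraction.

(** * Perturbations with a finite attractor *)

Section Stepmap.
Context (m : nat) (sg : bool) (q q' : bits -> bits).
Context (q_agree : forall x y, agree m x y -> agree m (q x) (q y)).
Context (q'_agree : forall x y, agree m x y -> agree m (q' x) (q' y)).

(* The part of the sign-[b] half that pushing with [r] leaves uncovered. *)
Definition remainder (b : bool) (r : bits -> bits) (x : bits) : Prop :=
  x m = b /\ ~ (pop m x m = x m /\ agree m (r (pop m x)) x).

(* Pushes with [q] on the sign [sg], undoes pushes with [q'] on the opposite sign,
   and follows [H] where there is nothing to undo. *)
Definition stepmap (H : bits -> bits) (x : bits) : bits :=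
  if Bool.bool_dec (x m) sg then push m (q x) sg x
  else if excluded_middle_informative (pop m x m = x m /\ agree m (q' (pop m x)) x)
  then pop m x else H x.

Lemma stepmap_push H x : x m = sg -> stepmap H x = push m (q x) sg x.
Proof. intros E. unfold stepmap. now destruct (Bool.bool_dec _ _). Qed.

Lemma stepmap_pop H x : x m = negb sg ->
  pop m x m = x m /\ agree m (q' (pop m x)) x -> stepmap H x = pop m x.
Proof.
  intros E K. unfold stepmap. destruct (Bool.bool_dec _ _) as [E'|_].
  - exfalso. rewrite E in E'. now destruct sg.
  - now destruct (excluded_middle_informative _).
Qed.

Lemma stepmap_rem H x : remainder (negb sg) q' x -> stepmap H x = H x.
Proof.
  intros [E K]. unfold stepmap. destruct (Bool.bool_dec _ _) as [E'|_].
  - exfalso. rewrite E in E'. now destruct sg.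
  - now destruct (excluded_middle_informative _).
Qed.

Lemma stepmap_cases x :
  x m = sg \/
  (x m = negb sg /\ pop m x m = x m /\ agree m (q' (pop m x)) x) \/
  remainder (negb sg) q' x.
Proof.
  unfold remainder.
  destruct (excluded_middle_informative (pop m x m = x m /\ agree m (q' (pop m x)) x));
    destruct (x m), sg; simpl; tauto.
Qed.

Lemma popping_local r x y :
  (forall x y, agree m x y -> agree m (r x) (r y)) ->
  agree (S m + S m) x y ->
  pop m x m = x m /\ agree m (r (pop m x)) x -> pop m y m = y m /\ agree m (r (pop m y)) y.
Proof.
  intros Hr Hxy [E K].
  pose proof (pop_agree _ _ _ _ Hxy) as Hp. split.
  - rewrite <- Hp, <- Hxy by lia. exact E.
  - apply agree_trans with (r (pop m x)).
    + apply Hr, agree_sym. apply agree_le with (2 := Hp). lia.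
    + apply agree_trans with x; auto. apply agree_le with (2 := Hxy). lia.
Qed.

Lemma remainder_local b r x y :
  (forall x y, agree m x y -> agree m (r x) (r y)) ->
  agree (S m + S m) x y -> remainder b r x -> remainder b r y.
Proof.
  intros Hr Hxy [E K]. split.
  - rewrite <- Hxy by lia. exact E.
  - intros K'. apply K. apply popping_local with y; auto using agree_sym.
Qed.

(** The first [2 * (m + 1)] letters decide which case applies, so the cases are clopen and can be
    treated separately. *)
Lemma stepmap_continuous H :
  (forall x, remainder (negb sg) q' x ->
     forall n, exists k, forall y, agree k x y -> agree n (H x) (H y)) ->
  bcontinuous (stepmap H).
Proof.
  intros HH x n. destruct (stepmap_cases x) as [E|[[E K]|K]].
  - exists (S m + n). intros y Hy. rewrite !stepmap_push; auto.
    + apply agree_le with (S m + n); [lia|]. apply push_agree.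
      * apply q_agree. apply agree_le with (2 := Hy). lia.
      * apply agree_le with (2 := Hy). lia.
    + rewrite <- Hy by lia. exact E.
  - exists (S m + S m + n). intros y Hy.
    assert (Hy' : agree (S m + S m) x y) by (apply agree_le with (2 := Hy); lia).
    rewrite !stepmap_pop; auto.
    + apply pop_agree. apply agree_le with (2 := Hy). lia.
    + rewrite <- Hy by lia. exact E.
    + apply popping_local with x; auto.
  - destruct (HH x K n) as [k Hk]. exists (S m + S m + k). intros y Hy.
    rewrite !stepmap_rem; auto.
    + apply Hk. apply agree_le with (2 := Hy). lia.
    + apply remainder_local with x; auto. apply agree_le with (2 := Hy). lia.
Qed.

End Stepmap.

(** Inversion exchanges pushes and pops: the inverse is a stepmap of the opposite sign with [q] and
    [q'] interchanged, and [H'] undoes [H] between the remainders. *)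
Lemma stepmap_inverse m sg q q' H H' :
  (forall x, remainder m (negb sg) q' x -> remainder m sg q (H x) /\ H' (H x) = x) ->
  forall x, stepmap m (negb sg) q' q H' (stepmap m sg q q' H x) = x.
Proof.
  intros HH x. destruct (stepmap_cases m sg q' x) as [E|[[E [K1 K2]]|K]].
  - rewrite (stepmap_push _ _ _ _ _ x) by auto.
    rewrite stepmap_pop; rewrite ?pop_push, ?push_sign; auto.
    + now destruct sg.
    + split; auto. apply push_prefix.
  - rewrite (stepmap_pop _ _ _ _ _ x) by auto.
    rewrite stepmap_push by congruence. rewrite <- E. now apply push_pop.
  - destruct (HH x K) as [K1 K2]. rewrite (stepmap_rem _ _ _ _ _ x) by auto.
    rewrite stepmap_rem; auto. now rewrite Bool.negb_involutive.
Qed.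

(** * Cutting the remainders along edges *)

Section Pieces.
Context (m : nat) (sg : bool) (q q' : bits -> bits) (E : bits -> bits -> Prop).
Context (q_agree : forall x y, agree m x y -> agree m (q x) (q y)).
Context (q'_agree : forall x y, agree m x y -> agree m (q' x) (q' y)).
Context (E_agree : forall a a' b b', agree m a a' -> agree m b b' -> E a b -> E a' b').
Context (E_q' : forall x, E x (q' x)).

(** A choice of a neighbour whose cell is locally constant. The second block of the stack names it
    if that block is a neighbour and has the opposite sign; [q' x] is the default. Letting the stack
    choose makes every neighbour occur. *)
Definition exit_cell (x : bits) : bits :=
  if excluded_middle_informative (pop m x m = negb sg /\ E x (pop m x))
  then pop m x else q' x.

Definition piece (a b x : bits) : Prop :=
  remainder m sg q x /\ agree m x a /\ agree m (exit_cell x) b.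

Lemma exit_cell_edge x : E x (exit_cell x).
Proof. unfold exit_cell. destruct (excluded_middle_informative _); tauto || auto. Qed.

Lemma exit_cell_local x y :
  agree (S m + S m) x y -> agree m (exit_cell x) (exit_cell y).
Proof.
  intros Hxy. pose proof (pop_agree _ _ _ _ Hxy) as Hp.
  assert (Hp' : agree m (pop m x) (pop m y)) by (apply agree_le with (2 := Hp); lia).
  assert (Hxy' : agree m x y) by (apply agree_le with (2 := Hxy); lia).
  unfold exit_cell.
  destruct (excluded_middle_informative _) as [[H1 H2]|H1],
    (excluded_middle_informative _) as [[K1 K2]|K1]; auto; exfalso.
  - apply K1. split; [rewrite <- Hp by lia; auto|eauto].
  - apply H1. split; [rewrite Hp by lia; auto|].
    apply E_agree with y (pop m y); auto using agree_sym.
Qed.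

Lemma piece_local a b x y : agree (S m + S m) x y -> piece a b x -> piece a b y.
Proof.
  intros Hxy (H1 & H2 & H3). split; [|split].
  - eapply remainder_local; eauto.
  - apply agree_trans with x; auto. apply agree_sym.
    apply agree_le with (2 := Hxy). lia.
  - eapply agree_trans; [apply agree_sym, exit_cell_local, Hxy|auto].
Qed.

Lemma piece_nonempty a b : E a b -> exists x, piece a b x.
Proof.
  (* The change of sign between the two blocks puts the point in the remainder, and the second block
     names [b]. *)
  intros Hab. exists (push m a sg (push m b (negb sg) (fun _ => false))).
  split; [split|split].
  - apply push_sign.
  - rewrite pop_push, !push_sign. intros [H _]. now destruct sg.
  - apply agree_sym, push_prefix.
  - unfold exit_cell. rewrite pop_push, push_sign.
    destruct (excluded_middle_informative _) as [_|H].
    + apply agree_sym, push_prefix.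
    + exfalso. apply H. split; auto. eapply E_agree; eauto using push_prefix.
Qed.

End Pieces.

(** * The graph of cells *)

Section Edges.
Context (m : nat) (F F' : bits -> bits).
Context (FF' : forall x, F (F' x) = x).

(** Resetting the tail turns agreement to [m] into equality, so anything computed from [cell x]
    depends on the first [m] letters alone. *)
Definition cell (x : bits) : bits := push m x false (fun _ => false).

Definition edge (a b : bits) : Prop := exists z, agree m a z /\ agree m b (F z).

Definition succ_cell (x : bits) : bits := F (cell x).
Definition pred_cell (x : bits) : bits := F' (cell x).

Lemma cell_agree x : agree m x (cell x).
Proof. apply push_prefix. Qed.

Lemma cell_eq x y : agree m x y -> cell x = cell y.
Proof. apply push_eq. Qed.

Lemma edge_agree a a' b b' : agree m a a' -> agree m b b' -> edge a b -> edge a' b'.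
Proof.
  intros Ha Hb (z & H1 & H2).
  exists z; split; eapply agree_trans; eauto using agree_sym.
Qed.

Lemma edge_succ x : edge x (succ_cell x).
Proof. exists (cell x). split; [apply cell_agree|apply agree_refl]. Qed.

Lemma edge_pred x : edge (pred_cell x) x.
Proof.
  exists (pred_cell x). split; [apply agree_refl|]. unfold pred_cell.
  rewrite FF'. apply cell_agree.
Qed.

Lemma succ_cell_agree x y : agree m x y -> agree m (succ_cell x) (succ_cell y).
Proof. intros H. unfold succ_cell. rewrite (cell_eq x y H). apply agree_refl. Qed.

Lemma pred_cell_agree x y : agree m x y -> agree m (pred_cell x) (pred_cell y).
Proof. intros H. unfold pred_cell. rewrite (cell_eq x y H). apply agree_refl. Qed.

Definition rem_out : bits -> Prop := remainder m false pred_cell.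
Definition rem_in : bits -> Prop := remainder m true succ_cell.

(** Each remainder is cut into nonempty clopen pieces, one for every edge: [rem_out] by its cell and
    a chosen target, [rem_in] by its cell and a chosen source. Nonempty clopen sets are
    homeomorphic, so the pieces of the same edge are matched. *)
Lemma rem_homeo : exists H H',
  (forall x, rem_out x -> rem_in (H x) /\ H' (H x) = x /\ edge x (H x)) /\
  (forall x, rem_in x -> rem_out (H' x) /\ H (H' x) = x) /\
  (forall x, rem_out x -> forall n, exists k, forall y,
     agree k x y -> agree n (H x) (H y)) /\
  (forall x, rem_in x -> forall n, exists k, forall y,
     agree k x y -> agree n (H' x) (H' y)).
Proof.
  (* The reversed graph: in [rem_in] the first block is the end of the edge and the exit cell its
     beginning. *)
  set (op := fun b a => edge a b).
  set (tgt := exit_cell m false succ_cell edge).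
  set (src := exit_cell m true pred_cell op).
  set (W := piece m false pred_cell succ_cell edge).
  set (V := fun a b => piece m true succ_cell pred_cell op b a).
  assert (Hop : forall a a' b b', agree m a a' -> agree m b b' -> op a b -> op a' b').
  { unfold op. intros. eapply edge_agree; eauto. }
  assert (Ht : forall x, edge x (tgt x)) by (intros; apply exit_cell_edge, edge_succ).
  assert (Hs : forall x, edge (src x) x).
  { intros x. apply (exit_cell_edge m true pred_cell op edge_pred). }
  assert (Htl : forall x y, agree (S m + S m) x y -> cell (tgt x) = cell (tgt y)).
  { intros x y Hxy. apply cell_eq, exit_cell_local;
      auto using succ_cell_agree. exact edge_agree. }
  assert (Hsl : forall x y, agree (S m + S m) x y -> cell (src x) = cell (src y)).
  { intros x y Hxy. apply cell_eq, exit_cell_local; auto using pred_cell_agree. }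
  assert (Hc : forall a b, exists uv : (bits -> bits) * (bits -> bits), edge a b ->
    bcontinuous (fst uv) /\ bcontinuous (snd uv) /\
    (forall x, W a b x -> V a b (fst uv x) /\ snd uv (fst uv x) = x) /\
    (forall x, V a b x -> W a b (snd uv x) /\ fst uv (snd uv x) = x)).
  { intros a b. destruct (excluded_middle_informative (edge a b)) as [Hab|Hab].
    - destruct (clopen_homeo (S m + S m) (W a b) (V a b)) as (u & v & Huv).
      + apply piece_local; auto using pred_cell_agree, succ_cell_agree. exact edge_agree.
      + apply piece_nonempty; auto. exact edge_agree.
      + apply piece_local; auto using pred_cell_agree, succ_cell_agree.
      + apply piece_nonempty; auto.
      + exists (u, v). auto.
    - exists (fun x => x, fun x => x). intros; contradiction. }
  set (uv := fun a b => proj1_sig (constructive_indefinite_description _ (Hc a b))).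
  assert (Huv : forall a b, edge a b ->
    bcontinuous (fst (uv a b)) /\ bcontinuous (snd (uv a b)) /\
    (forall x, W a b x -> V a b (fst (uv a b) x) /\ snd (uv a b) (fst (uv a b) x) = x) /\
    (forall x, V a b x -> W a b (snd (uv a b) x) /\ fst (uv a b) (snd (uv a b) x) = x)).
  { intros a b. exact (proj2_sig (constructive_indefinite_description _ (Hc a b))). }
  clearbody uv. clear Hc.
  assert (Hce : forall a b, edge a b -> edge (cell a) (cell b)).
  { intros a b. apply edge_agree; apply cell_agree. }
  assert (HW : forall x, rem_out x -> W (cell x) (cell (tgt x)) x).
  { intros x Hx. split; [exact Hx|]. split; apply cell_agree. }
  assert (HV : forall x, rem_in x -> V (cell (src x)) (cell x) x).
  { intros x Hx. split; [exact Hx|]. split; apply cell_agree. }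
  assert (Hcell : forall x y, agree m x (cell y) -> cell x = cell y).
  { intros x y Hxy. apply cell_eq. eapply agree_trans; eauto.
    apply agree_sym, cell_agree. }
  (* Indexing by canonical points makes the chosen pair of maps locally constant in [x], which gives
     continuity. *)
  exists (fun x => fst (uv (cell x) (cell (tgt x))) x),
    (fun x => snd (uv (cell (src x)) (cell x)) x).
  split; [|split; [|split]].
  - intros x Hx. destruct (Huv _ _ (Hce _ _ (Ht x))) as (_ & _ & H1 & _).
    destruct (H1 x (HW x Hx)) as [[K1 [K2 K3]] K4]. split; [exact K1|].
    fold src in K3. split.
    + rewrite (Hcell _ _ K2), (Hcell _ _ K3). exact K4.
    + apply edge_agree with x (tgt x); auto using agree_refl.
      eapply agree_trans; [apply cell_agree|]. now apply agree_sym.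
  - intros x Hx. destruct (Huv _ _ (Hce _ _ (Hs x))) as (_ & _ & _ & H1).
    destruct (H1 x (HV x Hx)) as [[K1 [K2 K3]] K4]. split; [exact K1|].
    fold tgt in K3. now rewrite (Hcell _ _ K2), (Hcell _ _ K3).
  - intros x Hx n. destruct (Huv _ _ (Hce _ _ (Ht x))) as (H1 & _).
    destruct (H1 x n) as [k Hk]. exists (S m + S m + k). intros y Hy.
    rewrite <- (Htl x y), <- (cell_eq x y).
    + apply Hk. apply agree_le with (2 := Hy). lia.
    + apply agree_le with (2 := Hy). lia.
    + apply agree_le with (2 := Hy). lia.
  - intros x Hx n. destruct (Huv _ _ (Hce _ _ (Hs x))) as (_ & H1 & _).
    destruct (H1 x n) as [k Hk]. exists (S m + S m + k). intros y Hy.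
    rewrite <- (Hsl x y), <- (cell_eq x y).
    + apply Hk. apply agree_le with (2 := Hy). lia.
    + apply agree_le with (2 := Hy). lia.
    + apply agree_le with (2 := Hy). lia.
Qed.

(** [P] collects the [T]-periodic points of [G] of sign [true] and the [T']-periodic points of [G']
    of sign [false]. An orbit that reaches the sign [true] keeps it and is attracted by the
    former. *)
Lemma edge_homeo_finite_attractor : exists G G',
  bhomeo G G' /\ (forall x, edge x (G x)) /\
  exists P : list bits, forall x n, exists K, forall j, K <= j ->
    exists p, In p P /\ agree n p (Nat.iter j G x).
Proof.
  destruct rem_homeo as (H & H' & HH & HH' & HC & HC').
  set (G := stepmap m true succ_cell pred_cell H).
  set (G' := stepmap m false pred_cell succ_cell H').
  assert (G'G : forall x, G' (G x) = x).
  { apply (stepmap_inverse m true). intros x Hx. now destruct (HH x Hx) as (? & ? & _). }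
  assert (GG' : forall x, G (G' x) = x).
  { apply (stepmap_inverse m false). exact HH'. }
  exists G, G'. split; [|split].
  - repeat split; auto.
    + apply stepmap_continuous; auto using succ_cell_agree, pred_cell_agree.
    + apply stepmap_continuous; auto using succ_cell_agree, pred_cell_agree.
  - intros x. unfold G.
    destruct (stepmap_cases m true pred_cell x) as [E|[[E K]|K]].
    + rewrite stepmap_push by auto. eapply edge_agree; [| |apply (edge_succ x)];
        auto using agree_refl, push_prefix.
    + rewrite stepmap_pop by auto. eapply edge_agree; [| |apply edge_pred];
        [apply K|apply agree_refl].
    + rewrite stepmap_rem by auto. apply HH, K.
  - assert (Gp : forall x : bits, x m = true -> G x = push m (succ_cell x) true x).
    { intros; now apply stepmap_push. }
    assert (G'p : forall x : bits, x m = false -> G' x = push m (pred_cell x) false x).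
    { intros; now apply stepmap_push. }
    destruct (cell_periodic_uniform m _ _ _ succ_cell_agree Gp) as (T & HT & HP).
    destruct (cell_periodic_uniform m _ _ _ pred_cell_agree G'p) as (T' & HT' & HP').
    destruct (periodic_finite m _ _ _ succ_cell_agree Gp T HT) as [l Hl].
    destruct (periodic_finite m _ _ _ pred_cell_agree G'p T' HT') as [l' Hl'].
    exists (l ++ l'). intros x n.
    destruct (excluded_middle_informative (exists j, Nat.iter j G x m = true)) as [[j0 Hj0]|Hno].
    + exists (j0 + (T + n)). intros j Hj.
      destruct (approaches_periodic m _ _ _ succ_cell_agree Gp T _ HT Hj0 (HP _ Hj0)
        n (j - j0)) as (w & Sw & Ew & Aw); [lia|].
      exists w. split; [apply in_or_app; auto|].
      rewrite <- Nat.iter_add in Aw. now replace (j - j0 + j0) with j in Aw by lia.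
    + (* A point whose forward orbit keeps the sign [false] is a point of the
         contracted set of [G'], since it is the [G']-image of its own future. *)
      exists 0. intros j _. exists (Nat.iter j G x). split; [|apply agree_refl].
      apply in_or_app; right.
      assert (Hs : forall i, Nat.iter i G x m = false).
      { intros i. destruct (Nat.iter i G x m) eqn:E; auto. exfalso; eauto. }
      apply Hl'. split; auto.
      assert (Hback : forall i y, Nat.iter i G' (Nat.iter i G y) = y).
      { induction i as [|i IH]; intros y; simpl; auto.
        rewrite <- Nat.iter_swap. now rewrite G'G. }
      (* Going back [T' + k] steps from time [T' + k + j] gives time [j], and by contraction [T']
         further steps back change nothing up to depth [k]. *)
      apply agree_all. intros k.
      pose proof (cell_periodic_contract m _ _ _ pred_cell_agree G'p T' _ (Hs (T' + k + j))
        (HP' _ (Hs _)) k (T' + k) (le_n _)) as Hk.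
      replace (T' + k + T') with (T' + (T' + k)) in Hk by lia.
      now rewrite (Nat.iter_add T' (T' + k)), (Nat.iter_add (T' + k) j), Hback in Hk.
Qed.

End Edges.

(** Cells finer than the moduli of [F] and [F'] make every map along edges close to [F]. For the
    inverse, the edge leaving [G' y] is read backwards from [y]. *)
Lemma finite_attractor_perturbation (F F' : bits -> bits) :
  buniform F -> buniform F' -> (forall x, F' (F x) = x) -> (forall x, F (F' x) = x) ->
  forall n, exists G G', bhomeo G G' /\ (forall x, agree n (F x) (G x)) /\
    (forall x, agree n (F' x) (G' x)) /\
    exists P : list bits, forall x k, exists K, forall j, K <= j ->
      exists p, In p P /\ agree k p (Nat.iter j G x).
Proof.
  intros HF HF' F'F FF' n.
  destruct (HF n) as [m1 Hm1]. destruct (HF' n) as [m2 Hm2].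
  set (m := max n (max m1 m2)).
  destruct (edge_homeo_finite_attractor m F F' FF') as (G & G' & HG & HE & HP).
  exists G, G'. split; [exact HG|split; [|split; [|exact HP]]].
  - intros x. destruct (HE x) as (z & H1 & H2). apply agree_trans with (F z).
    + apply Hm1. apply agree_le with (2 := H1). lia.
    + apply agree_sym. apply agree_le with (2 := H2). lia.
  - intros y. destruct (HE (G' y)) as (z & H1 & H2).
    destruct HG as (_ & _ & _ & GG'). rewrite GG' in H2.
    apply agree_trans with z.
    + rewrite <- (F'F z). apply Hm2. apply agree_le with (2 := H2). lia.
    + apply agree_sym. apply agree_le with (2 := H1). lia.
Qed.

Local Open Scope R_scope.

(** * Coding a Cantor space by binary sequences *)

Section CompactMetric.
Context {X : Type} (d : X -> X -> R).
Context (d_metric : is_metric d) (d_compact : compact d).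

Lemma dist_refl x : d x x = 0.
Proof. now apply d_metric. Qed.

Lemma dist_sym x y : d x y = d y x.
Proof. apply d_metric. Qed.

Lemma dist_tri x y z : d x z <= d x y + d y z.
Proof. apply d_metric. Qed.

Lemma dist_pos x y : x <> y -> 0 < d x y.
Proof.
  intros H. destruct d_metric as (H0 & H1 & _). destruct (H0 x y) as [|E]; auto.
  exfalso. apply H, H1. auto.
Qed.

Lemma open_and U V : open d U -> open d V -> open d (fun x => U x /\ V x).
Proof.
  intros HU HV x [Ux Vx].
  destruct (HU x Ux) as (r & Hr & Ur), (HV x Vx) as (s & Hs & Vs).
  exists (Rmin r s). split; [now apply Rmin_glb_lt|].
  intros y Hy. split; [apply Ur|apply Vs]; eapply Rlt_le_trans; eauto.
  - apply Rmin_l.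
  - apply Rmin_r.
Qed.

Lemma open_or U V : open d U -> open d V -> open d (fun x => U x \/ V x).
Proof.
  intros HU HV x [Ux|Vx].
  - destruct (HU x Ux) as (r & Hr & Ur). exists r; auto.
  - destruct (HV x Vx) as (r & Hr & Vr). exists r; auto.
Qed.

Lemma open_ext U V : (forall x, U x <-> V x) -> open d U -> open d V.
Proof.
  intros E HU x Vx. destruct (HU x) as (r & Hr & Ur); [now apply E|].
  exists r. split; auto. intros y Hy. apply E; auto.
Qed.

Lemma ball_open x r : open d (fun y => d x y < r).
Proof.
  intros y Hy. exists (r - d x y). split; [lra|].
  intros z Hz. pose proof (dist_tri x y z). lra.
Qed.

Lemma coball_open x r : open d (fun y => ~ r <= d x y).
Proof. eapply open_ext; [|apply (ball_open x r)]. intros y; lra. Qed.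

(** Cantor's intersection theorem: otherwise the complements cover the space, and the largest index
    in a finite subcover gives an empty set. *)
Lemma nested_nonempty (C : nat -> X -> Prop) :
  (forall k, open d (fun x => ~ C k x)) ->
  (forall k x, C (S k) x -> C k x) -> (forall k, exists x, C k x) ->
  exists x, forall k, C k x.
Proof.
  intros HO HS HE. apply NNPP. intros Hno.
  destruct (d_compact nat (fun k x => ~ C k x) HO) as [l Hl].
  { intros x. apply not_all_ex_not. intros Hx. apply Hno; eauto. }
  assert (Hle : forall j k x, (j <= k)%nat -> C k x -> C j x).
  { intros j k x Hjk. induction Hjk; auto. }
  destruct (HE (list_max l)) as [x Hx]. destruct (Hl x) as (i & Hi & Hn).
  apply Hn. apply Hle with (list_max l); auto.
  pose proof (proj1 (list_max_le l (list_max l)) (le_n _)) as HF.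
  rewrite Forall_forall in HF. auto.
Qed.

(** Lebesgue's number lemma, stated for a relation that holds near the diagonal. Balls of radius [s]
    cover while [Q] holds on those of radius [2 * s], which leaves room for a second point. *)
Lemma lebesgue_number (Q : X -> X -> Prop) :
  (forall x, exists r, 0 < r /\ forall y z, d x y < r -> d x z < r -> Q y z) ->
  exists r, 0 < r /\ forall y z, d y z < r -> Q y z.
Proof.
  intros HQ.
  set (I := {xr : X * R | 0 < snd xr /\
    forall y z, d (fst xr) y < 2 * snd xr -> d (fst xr) z < 2 * snd xr -> Q y z}).
  destruct (d_compact I (fun i y => d (fst (proj1_sig i)) y < snd (proj1_sig i)))
    as [l Hl].
  - intros i. apply ball_open.
  - intros x. destruct (HQ x) as (r & Hr & Hx).
    assert (Hi : 0 < snd (x, r / 2) /\ forall y z, d (fst (x, r / 2)) y < 2 * snd (x, r / 2) ->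
      d (fst (x, r / 2)) z < 2 * snd (x, r / 2) -> Q y z).
    { simpl. split; [lra|]. intros y z Hy Hz. apply Hx; lra. }
    exists (exist _ (x, r / 2) Hi). simpl. rewrite dist_refl. lra.
  - assert (Hmin : exists r, 0 < r /\ forall i : I, In i l -> r <= snd (proj1_sig i)).
    { clear Hl. induction l as [|i l (r & Hr & IH)].
      - exists 1. split; [lra|]. intros i [].
      - exists (Rmin r (snd (proj1_sig i))). split.
        + apply Rmin_glb_lt; auto. apply (proj2_sig i).
        + intros j [<-|Hj]; [apply Rmin_r|].
          eapply Rle_trans; [apply Rmin_l|auto]. }
    destruct Hmin as (r & Hr & Hmin). exists r. split; auto.
    intros y z Hyz. destruct (Hl y) as (i & Hi & Hy). specialize (Hmin i Hi).
    destruct i as [[x s] [Hs Hx]]; simpl in *.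
    pose proof (dist_tri x y z). apply Hx; lra.
Qed.

Lemma uniform_continuity (f : X -> X) : continuous d f ->
  forall eps, 0 < eps -> exists delta, 0 < delta /\
    forall x y, d x y < delta -> d (f x) (f y) < eps.
Proof.
  intros Hf eps He. apply (lebesgue_number (fun x y => d (f x) (f y) < eps)).
  intros x. destruct (Hf x (eps / 2)) as (r & Hr & Hx); [lra|].
  exists r. split; auto. intros y z Hy Hz. apply Hx in Hy, Hz.
  pose proof (dist_tri (f y) (f x) (f z)). rewrite (dist_sym (f y) (f x)) in H. lra.
Qed.

(** * Clopen sets and quasicomponents *)

Definition clopen (A : X -> Prop) : Prop := open d A /\ open d (fun x => ~ A x).

Lemma clopen_and A B : clopen A -> clopen B -> clopen (fun x => A x /\ B x).
Proof.
  intros [A1 A2] [B1 B2]. split; [now apply open_and|].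
  eapply open_ext; [|apply (open_or _ _ A2 B2)]. intros x; tauto.
Qed.

Lemma clopen_not A : clopen A -> clopen (fun x => ~ A x).
Proof.
  intros [A1 A2]. split; auto. eapply open_ext; [|apply A1].
  intros x. split; [tauto|apply NNPP].
Qed.

Lemma clopen_True : clopen (fun _ => True).
Proof.
  split; intros x Hx; [|now contradiction Hx].
  exists 1. split; [lra|auto].
Qed.

Definition quasicomponent (x z : X) : Prop := forall A, clopen A -> A x -> A z.

(** [O] and the complements of the clopen neighbourhoods of [x] cover the space. The neighbourhoods
    in a finite subcover intersect in [W]. *)
Lemma clopen_in_open (x : X) (O : X -> Prop) :
  open d O -> (forall z, quasicomponent x z -> O z) ->
  exists W, clopen W /\ W x /\ forall z, W z -> O z.
Proof.
  intros HO HQ.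
  destruct (d_compact (option {A | clopen A /\ A x})
    (fun o z => match o with None => O z | Some A => ~ proj1_sig A z end)) as [l Hl].
  - intros [[A [HA Hx]]|]; auto. apply HA.
  - intros z. destruct (excluded_middle_informative (O z)) as [Hz|Hz].
    + exists None; auto.
    + assert (HA : exists A, clopen A /\ A x /\ ~ A z).
      { apply NNPP. intros Hno. apply Hz, HQ. intros A H1 H2.
        apply NNPP. intros H3. apply Hno. eauto. }
      destruct HA as (A & H1 & H2 & HA).
      exists (Some (exist _ A (conj H1 H2))). exact HA.
  - exists (fun z => forall A, In (Some A) l -> proj1_sig A z). split; [|split].
    + clear Hl. induction l as [|o l IH].
      * assert (E : forall z, True <-> (forall A : {A | clopen A /\ A x}, In (Some A) nil -> proj1_sig A z)).
        { intros z; split; auto. intros _ A []. }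
        split; [eapply open_ext; [apply E|apply clopen_True]|].
        eapply open_ext; [|apply clopen_True]. intros z. specialize (E z). tauto.
      * destruct o as [A|].
        -- assert (E : forall z, (proj1_sig A z /\ forall B, In (Some B) l -> proj1_sig B z) <->
             (forall B, In (Some B) (Some A :: l) -> proj1_sig B z)).
           { intros z; split.
             - intros [H1 H2] B [HB|HB]; [|auto]. injection HB as ->. exact H1.
             - intros H. split; [apply H; now left|]. intros B HB. apply H. now right. }
           destruct (clopen_and _ _ (proj1 (proj2_sig A)) IH) as [K1 K2].
           split; [eapply open_ext; [apply E|apply K1]|].
           eapply open_ext; [|apply K2]. intros z. specialize (E z). cbv beta. tauto.
        -- assert (E : forall z, (forall B, In (Some B) l -> proj1_sig B z) <->
             (forall B, In (Some B) (None :: l) -> proj1_sig B z)).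
           { intros z; split.
             - intros H B [HB|HB]; [discriminate|auto].
             - intros H B HB. apply H. now right. }
           destruct IH as [K1 K2].
           split; [eapply open_ext; [apply E|apply K1]|].
           eapply open_ext; [|apply K2]. intros z. specialize (E z). cbv beta. tauto.
    + intros A _. apply (proj2_sig A).
    + intros z Hz. destruct (Hl z) as ([A|] & HA & Hn); auto.
      contradiction Hn; auto.
Qed.

(** If [U] and [V] split the quasicomponent, they are enlarged to disjoint open sets whose union
    contains a clopen [W] around [x]. The part of [W] on the side of [x] is clopen, so the
    quasicomponent stays on that side. *)
Lemma quasicomponent_connected (x : X) : connected d (quasicomponent x).
Proof.
  assert (Hside : forall U V, open d U -> open d V ->
    (forall z, quasicomponent x z -> U z \/ V z) ->
    (forall z, ~ (quasicomponent x z /\ U z /\ V z)) ->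
    U x -> forall z, quasicomponent x z -> U z).
  { intros U V HU HV Hc Hd Ux.
    (* The traces of [U] and [V] are separated by disjoint open sets of the whole space. *)
    set (U' := fun z => exists a r, (quasicomponent x a /\ U a) /\ d a z < r /\
      forall b, quasicomponent x b /\ V b -> 2 * r <= d a b).
    set (V' := fun z => exists b r, (quasicomponent x b /\ V b) /\ d b z < r /\
      forall a, quasicomponent x a /\ U a -> 2 * r <= d a b).
    assert (U'o : open d U').
    { intros z (a & r & Ha & Hr & Hb). exists (r - d a z). split; [lra|].
      intros y Hy. exists a, r. split; [exact Ha|split; [|exact Hb]].
      pose proof (dist_tri a z y). lra. }
    assert (V'o : open d V').
    { intros z (a & r & Ha & Hr & Hb). exists (r - d a z). split; [lra|].
      intros y Hy. exists a, r. split; [exact Ha|split; [|exact Hb]].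
      pose proof (dist_tri a z y). lra. }
    assert (Hdis : forall z, U' z -> V' z -> False).
    { intros z (a & r & Ha & Hr & Hb) (b & s & Hb' & Hs & Ha').
      specialize (Hb b Hb'). specialize (Ha' a Ha).
      pose proof (dist_tri a z b). rewrite (dist_sym z b) in H. lra. }
    assert (HUU' : forall z, quasicomponent x z -> U z -> U' z).
    { intros z Qz Uz. destruct (HU z Uz) as (r & Hr & Hz).
      exists z, (r / 2). split; [auto|split].
      - rewrite dist_refl. lra.
      - intros b [Qb Vb]. destruct (Rlt_le_dec (d z b) r) as [Hlt|]; [|lra].
        exfalso. apply (Hd b); auto. }
    assert (HVV' : forall z, quasicomponent x z -> V z -> V' z).
    { intros z Qz Vz. destruct (HV z Vz) as (r & Hr & Hz).
      exists z, (r / 2). split; [auto|split].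
      - rewrite dist_refl. lra.
      - intros b [Qb Ub]. rewrite dist_sym.
        destruct (Rlt_le_dec (d z b) r) as [Hlt|]; [|lra].
        exfalso. apply (Hd b); auto. }
    destruct (clopen_in_open x (fun z => U' z \/ V' z)) as (W & HW & Wx & HWO).
    { now apply open_or. }
    { intros z Qz. destruct (Hc z Qz); auto. }
    (* Within [W], being outside [U'] means being in [V'], so the complement is open too. *)
    assert (HD : clopen (fun z => W z /\ U' z)).
    { split; [apply open_and; auto; apply HW|].
      eapply open_ext; [|apply (open_or _ _ (proj2 HW) V'o)].
      intros z. specialize (Hdis z). specialize (HWO z). tauto. }
    assert (Qx : quasicomponent x x) by (intros A _ Ax; exact Ax).
    intros z Qz. destruct (Hc z Qz) as [|Vz]; auto. exfalso.
    apply (Hdis z); auto. apply (Qz _ HD). auto. }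
  intros U V HU HV Hc Hd.
  destruct (Hc x) as [Ux|Vx].
  - intros A _ Ax; exact Ax.
  - left. apply Hside with V; auto.
  - right. apply Hside with U; auto.
    + intros z Qz. destruct (Hc z Qz); auto.
    + intros z Hz. apply (Hd z). tauto.
Qed.

Context (d_totdisc : totally_disconnected d).

Lemma quasicomponent_eq x z : quasicomponent x z -> z = x.
Proof.
  intros Hz. apply (d_totdisc _ (quasicomponent_connected x)); auto.
  intros A _ Ax; exact Ax.
Qed.

Lemma clopen_basis x eps : 0 < eps ->
  exists A, clopen A /\ A x /\ forall y, A y -> d x y < eps.
Proof.
  intros He. apply clopen_in_open; [apply ball_open|].
  intros z Hz. rewrite (quasicomponent_eq _ _ Hz), dist_refl. exact He.
Qed.

Lemma clopen_small_cover eps : 0 < eps -> exists l : list (X -> Prop),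
  (forall A, In A l -> clopen A /\ forall y z, A y -> A z -> d y z < eps) /\
  forall x, exists A, In A l /\ A x.
Proof.
  intros He.
  set (small := fun A => clopen A /\ forall y z, A y -> A z -> d y z < eps).
  destruct (d_compact {A | small A} (fun i => proj1_sig i)) as [l Hl].
  - intros [A [HA Hs]]. apply HA.
  - intros x. destruct (clopen_basis x (eps / 2)) as (A & HA & Ax & Hs); [lra|].
    assert (Hi : small A).
    { split; auto. intros y z Hy Hz. apply Hs in Hy, Hz.
      pose proof (dist_tri y x z). rewrite (dist_sym y x) in H. lra. }
    exists (exist _ A Hi). exact Ax.
  - exists (map (fun i => proj1_sig i) l). split.
    + intros A HA. apply in_map_iff in HA as ([B HB] & <- & _). exact HB.
    + intros x. destruct (Hl x) as (i & Hi & Hx). exists (proj1_sig i). split; auto.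
      now apply (in_map (fun i : {A | small A} => proj1_sig i)).
Qed.

Lemma clopen_sequence : exists C : nat -> X -> Prop,
  (forall k, clopen (C k)) /\ forall x y, (forall k, C k x <-> C k y) -> x = y.
Proof.
  assert (Hpos : forall n, 0 < / INR (S n)).
  { intros n. apply Rinv_0_lt_compat, lt_0_INR. lia. }
  set (L := fun n => proj1_sig (constructive_indefinite_description _
    (clopen_small_cover _ (Hpos n)))).
  assert (HL : forall n,
    (forall A, In A (L n) -> clopen A /\ forall y z, A y -> A z -> d y z < / INR (S n)) /\
    forall x, exists A, In A (L n) /\ A x).
  { intros n. exact (proj2_sig (constructive_indefinite_description _
      (clopen_small_cover _ (Hpos n)))). }
  clearbody L.
  (* The finite covers of mesh [1 / (n + 1)] are listed along Cantor's pairing; past the end of a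
     list the empty set is the default. *)
  exists (fun k => nth (snd (Cantor.of_nat k)) (L (fst (Cantor.of_nat k))) (fun _ => ~ True)).
  split.
  - intros k. destruct (nth_in_or_default (snd (Cantor.of_nat k))
      (L (fst (Cantor.of_nat k))) (fun _ => ~ True)) as [Hin| ->].
    + apply HL in Hin. apply Hin.
    + apply clopen_not, clopen_True.
  - intros x y Hxy. apply NNPP. intros Hne.
    destruct (archimed_cor1 (d x y) (dist_pos _ _ Hne)) as (n & Hn & Hn0).
    destruct n as [|n]; [lia|].
    destruct (HL n) as [H1 H2]. destruct (H2 x) as (A & HA & Ax).
    destruct (In_nth _ _ (fun _ => ~ True) HA) as (i & Hi & Ei).
    specialize (Hxy (Cantor.to_nat (n, i))). rewrite Cantor.cancel_of_to in Hxy.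
    simpl in Hxy. rewrite Ei in Hxy. apply Hxy in Ax as Ay.
    destruct (H1 A HA) as [_ Hs]. specialize (Hs x y Ax Ay). simpl in *. lra.
Qed.

(** * The binary tree of clopen sets *)

Context (d_perfect : no_isolated_points d).

(** If [C] cuts [B] properly, it is itself the splitting set. Otherwise [C] is constant on [B], and
    a small clopen neighbourhood of a point splits [B] as that point is not isolated. *)
Lemma clopen_split (C B : X -> Prop) : clopen C -> clopen B -> (exists x, B x) ->
  exists D, clopen D /\ (exists x, B x /\ D x) /\ (exists x, B x /\ ~ D x) /\
    forall x y, B x -> B y -> (D x <-> D y) -> (C x <-> C y).
Proof.
  intros HC HB [x Bx].
  destruct (excluded_middle_informative ((exists x, B x /\ C x) /\ (exists x, B x /\ ~ C x)))
    as [[H1 H2]|Hno].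
  - exists C. auto.
  - destruct (proj1 HB x Bx) as (r & Hr & Hball).
    destruct (d_perfect x r Hr) as (y & Hy & Hxy).
    destruct (clopen_basis x (d x y)) as (D & HD & Dx & Ds); [now apply dist_pos; auto|].
    exists D. split; [auto|split; [eauto|split]].
    + exists y. split; auto. intros Dy. specialize (Ds y Dy). lra.
    + intros a b Ba Bb _.
      destruct (excluded_middle_informative (C a)), (excluded_middle_informative (C b));
        try tauto; exfalso; apply Hno; split; eauto.
Qed.

(** For the second claim, the cylinders around [phi x] shrink to [x] by injectivity and compactness,
    and finitely many small ones cover the space. *)
Lemma uniform_of_injective_coding (phi : X -> bits) :
  (forall x y, phi x = phi y -> x = y) ->
  (forall x n, exists r, 0 < r /\ forall y, d x y < r -> agree n (phi x) (phi y)) ->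
  (forall n, exists r, 0 < r /\ forall x y, d x y < r -> agree n (phi x) (phi y)) /\
  (forall eps, 0 < eps -> exists n, forall x y,
     agree n (phi x) (phi y) -> d x y < eps).
Proof.
  intros Hinj Hc.
  assert (Hcyl : forall x n, open d (fun y => agree n (phi x) (phi y))).
  { intros x n y Hy. destruct (Hc y n) as (r & Hr & Hz). exists r. split; auto.
    intros z Hyz. eapply agree_trans; eauto. }
  assert (Hcocyl : forall x n, open d (fun y => ~ agree n (phi x) (phi y))).
  { intros x n y Hy. destruct (Hc y n) as (r & Hr & Hz). exists r. split; auto.
    intros z Hyz Ha. apply Hy. eapply agree_trans; eauto. apply agree_sym; auto. }
  split.
  - intros n. apply (lebesgue_number (fun x y => agree n (phi x) (phi y))).
    intros x. destruct (Hc x n) as (r & Hr & Hx). exists r. split; auto.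
    intros y z Hy Hz. eapply agree_trans; [apply agree_sym|]; apply Hx; auto.
  - intros eps He.
    assert (Hloc : forall x, exists n, forall y, agree n (phi x) (phi y) -> d x y < eps / 2).
    { intros x. apply NNPP. intros Hno.
      destruct (nested_nonempty (fun n y => agree n (phi x) (phi y) /\ eps / 2 <= d x y))
        as [y Hy].
      - intros n. eapply open_ext;
          [|apply (open_or _ _ (Hcocyl x n) (coball_open x (eps / 2)))].
        intros y. cbv beta. tauto.
      - intros n y [H1 H2]. split; auto. apply agree_le with (2 := H1). lia.
      - intros n. apply NNPP. intros Hn. apply Hno. exists n. intros y Hy.
        destruct (Rlt_le_dec (d x y) (eps / 2)); auto. exfalso; eauto.
      - assert (E : x = y) by (apply Hinj, agree_all; intros n; apply Hy).
        destruct (Hy 0%nat) as [_ Hd]. rewrite <- E, dist_refl in Hd. lra. }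
    destruct (d_compact {xn : X * nat | forall y,
        agree (snd xn) (phi (fst xn)) (phi y) -> d (fst xn) y < eps / 2}
      (fun i y => agree (snd (proj1_sig i)) (phi (fst (proj1_sig i))) (phi y))) as [l Hl].
    + intros i. apply Hcyl.
    + intros x. destruct (Hloc x) as [n Hn].
      exists (exist (fun xn : X * nat => forall y,
        agree (snd xn) (phi (fst xn)) (phi y) -> d (fst xn) y < eps / 2) (x, n) Hn).
      apply agree_refl.
    + set (lev := map (fun i => snd (proj1_sig i)) l).
      exists (list_max lev). intros x y Hxy. destruct (Hl x) as (i & Hi & Hx).
      assert (Hle : (snd (proj1_sig i) <= list_max lev)%nat).
      { pose proof (proj1 (list_max_le lev (list_max lev)) (le_n _)) as HF.
        rewrite Forall_forall in HF. apply HF. unfold lev.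
        apply (in_map (fun i => snd (proj1_sig i)) l i Hi). }
      destruct i as [[z n] Hz]; simpl in *.
      assert (Hy : agree n (phi z) (phi y)).
      { eapply agree_trans; eauto. apply agree_le with (2 := Hxy). auto. }
      apply Hz in Hx, Hy. pose proof (dist_tri x z y). rewrite (dist_sym x z) in H. lra.
Qed.

Lemma cantor_coding (x0 : X) : exists (phi : X -> bits) (psi : bits -> X),
  (forall x, psi (phi x) = x) /\ (forall t, phi (psi t) = t) /\
  (forall n, exists r, 0 < r /\ forall x y, d x y < r -> agree n (phi x) (phi y)) /\
  (forall eps, 0 < eps -> exists n, forall x y,
     agree n (phi x) (phi y) -> d x y < eps).
Proof.
  destruct clopen_sequence as (C & HC & Csep).
  assert (Hsplit : forall B k, exists D, clopen B -> (exists x, B x) ->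
    clopen D /\ (exists x, B x /\ D x) /\ (exists x, B x /\ ~ D x) /\
    forall x y, B x -> B y -> (D x <-> D y) -> (C k x <-> C k y)).
  { intros B k.
    destruct (excluded_middle_informative (clopen B /\ exists x, B x)) as [[H1 H2]|Hno].
    - destruct (clopen_split (C k) B (HC k) H1 H2) as [D HD]. exists D; auto.
    - exists B. intros; exfalso; apply Hno; auto. }
  set (split := fun B k => proj1_sig (constructive_indefinite_description _ (Hsplit B k))).
  assert (HD : forall B k, clopen B -> (exists x, B x) ->
    clopen (split B k) /\ (exists x, B x /\ split B k x) /\ (exists x, B x /\ ~ split B k x) /\
    forall x y, B x -> B y -> (split B k x <-> split B k y) -> (C k x <-> C k y)).
  { intros B k. exact (proj2_sig (constructive_indefinite_description _ (Hsplit B k))). }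
  clearbody split. clear Hsplit.
  (* Nodes are addressed by reversed words: the head is the last choice made. *)
  set (node := fix node (w : list bool) : X -> Prop :=
    match w with
    | nil => fun _ => True
    | b :: w => fun x => node w x /\
        (if b then split (node w) (length w) x else ~ split (node w) (length w) x)
    end).
  assert (Hnode : forall w, clopen (node w) /\ exists x, node w x).
  { induction w as [|b w [IH1 IH2]].
    - split; [apply clopen_True|]. exists x0; exact I.
    - destruct (HD (node w) (length w) IH1 IH2) as (H1 & H2 & H3 & _).
      destruct b; split; auto.
      + apply (clopen_and _ _ IH1 H1).
      + apply (clopen_and _ _ IH1 (clopen_not _ H1)). }
  set (word := fix word (t : bits) (k : nat) : list bool :=
    match k with 0%nat => nil | S k => t k :: word t k end).
  assert (word_len : forall t k, length (word t k) = k).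
  { intros t k. induction k; simpl; auto. }
  assert (word_agree : forall t t' k, word t k = word t' k <-> agree k t t').
  { intros t t' k. induction k as [|k IH]; simpl.
    - split; auto. intros _ i Hi; lia.
    - split.
      + intros E. injection E as E1 E2. apply IH in E2. intros i Hi.
        destruct (Nat.eq_dec i k) as [->|]; auto. apply E2; lia.
      + intros Ha. f_equal; [apply Ha; lia|]. apply IH. apply agree_le with (2 := Ha). lia. }
  set (pcode := fix pcode (x : X) (k : nat) : list bool :=
    match k with
    | 0%nat => nil
    | S k => (if excluded_middle_informative (split (node (pcode x k)) k x)
              then true else false) :: pcode x k
    end).
  set (phi := fun x k => if excluded_middle_informative (split (node (pcode x k)) k x)
    then true else false).
  assert (Hphi : forall x k, word (phi x) k = pcode x k).
  { intros x k. induction k as [|k IH]; simpl; auto. rewrite IH. reflexivity. }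
  assert (Hin : forall x k, node (word (phi x) k) x).
  { intros x k. induction k as [|k IH]; [exact I|]. cbn [word node].
    split; auto. rewrite word_len. unfold phi at 1. rewrite <- Hphi.
    destruct (excluded_middle_informative _); auto. }
  assert (Huniq : forall x t k, node (word t k) x -> agree k t (phi x)).
  { intros x t k H. apply word_agree. induction k as [|k IH]; auto.
    cbn [word node] in H. destruct H as [H1 H2]. specialize (IH H1).
    cbn [word]. f_equal; auto.
    rewrite word_len in H2. unfold phi. rewrite <- Hphi, <- IH.
    destruct (excluded_middle_informative _), (t k); auto; contradiction. }
  assert (Hinj : forall x y, phi x = phi y -> x = y).
  { intros x y E. apply Csep. intros k.
    destruct (Hnode (word (phi x) k)) as [H1 H2].
    destruct (HD _ k H1 H2) as (_ & _ & _ & H3).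
    pose proof (Hin x (S k)) as Hx. pose proof (Hin y (S k)) as Hy. rewrite <- E in Hy.
    cbn [word node] in Hx, Hy. rewrite word_len in Hx, Hy.
    apply H3; try tauto. destruct (phi x k); tauto. }
  assert (Hsurj : forall t, exists x, phi x = t).
  { intros t. destruct (nested_nonempty (fun k => node (word t k))) as [x Hx].
    - intros k. apply Hnode.
    - intros k x [H _]. exact H.
    - intros k. apply Hnode.
    - exists x. apply agree_all. intros n. apply agree_sym, Huniq, Hx. }
  set (psi := fun t => proj1_sig (constructive_indefinite_description _ (Hsurj t))).
  assert (Hpsi : forall t, phi (psi t) = t).
  { intros t. exact (proj2_sig (constructive_indefinite_description _ (Hsurj t))). }
  exists phi, psi. split; [|split; [exact Hpsi|]].
  - intros x. apply Hinj, Hpsi.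
  - apply uniform_of_injective_coding; auto.
    intros x n. destruct (Hnode (word (phi x) n)) as [[Ho _] _].
    destruct (Ho x (Hin x n)) as (r & Hr & Hx). exists r. split; auto.
Qed.

End CompactMetric.

(** * Perturbations of a homeomorphism of a Cantor space *)

(** The supremum may equal [e'], hence the gap below [e]; [x0] makes the set of distances
    nonempty. *)
Lemma dC0_lt_intro {X : Type} (d : X -> X -> R) (x0 : X) (f g : X -> X) (e e' : R) :
  (forall x, d (f x) (g x) <= e') -> e' < e -> dC0_lt d f g e.
Proof.
  intros H He.
  destruct (completeness (fun r => exists x, r = d (f x) (g x))) as [s Hs].
  - exists e'. intros r [x ->]. apply H.
  - exists (d (f x0) (g x0)). eauto.
  - exists s. split; auto. apply Rle_lt_trans with e'; auto.
    apply Hs. intros r [x ->]. apply H.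
Qed.

Lemma dC0_lt_elim {X : Type} (d : X -> X -> R) (f g : X -> X) (e : R) :
  dC0_lt d f g e -> forall x, d (f x) (g x) < e.
Proof.
  intros (s & [Hub _] & Hs) x. apply Rle_lt_trans with s; auto.
  apply Hub. eauto.
Qed.

Section Perturbation.
Context {X : Type} (d : X -> X -> R) (f finv : X -> X).
Context (HX : cantor_space d) (Hf : is_homeo d f finv).
Context (phi : X -> bits) (psi : bits -> X).
Context (psi_phi : forall x, psi (phi x) = x) (phi_psi : forall t, phi (psi t) = t).
Context (phi_unif : forall n, exists r, 0 < r /\
  forall x y, d x y < r -> agree n (phi x) (phi y)).
Context (psi_unif : forall eps, 0 < eps -> exists n, forall x y,
  agree n (phi x) (phi y) -> d x y < eps).

Lemma conjugate_buniform (u : X -> X) :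
  continuous d u -> buniform (fun t => phi (u (psi t))).
Proof.
  destruct HX as (Hd & Hc & _). intros Hu n.
  destruct (phi_unif n) as (r & Hr & Hphi).
  destruct (uniform_continuity d Hd Hc u Hu r Hr) as (s & Hs & Hus).
  destruct (psi_unif s Hs) as [m Hm]. exists m. intros x y Hxy.
  apply Hphi, Hus, Hm. now rewrite !phi_psi.
Qed.

Lemma conjugate_continuous (g : bits -> bits) :
  bcontinuous g -> continuous d (fun x => psi (g (phi x))).
Proof.
  intros Hg x eps He. destruct (psi_unif eps He) as [n Hn].
  destruct (Hg (phi x) n) as [m Hm]. destruct (phi_unif m) as (r & Hr & Hphi).
  exists r. split; auto. intros y Hy. apply Hn. rewrite !phi_psi. auto.
Qed.

Lemma conjugate_homeo (g g' : bits -> bits) : bhomeo g g' ->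
  is_homeo d (fun x => psi (g (phi x))) (fun x => psi (g' (phi x))).
Proof.
  intros (H1 & H2 & H3 & H4). repeat split.
  - now apply conjugate_continuous.
  - now apply conjugate_continuous.
  - intros x. now rewrite phi_psi, H3.
  - intros x. now rewrite phi_psi, H4.
Qed.

Lemma conjugate_iter (g : bits -> bits) (i : nat) (t : bits) :
  Nat.iter i (fun x => psi (g (phi x))) (psi t) = psi (Nat.iter i g t).
Proof.
  induction i as [|i IH]; simpl; auto. now rewrite IH, phi_psi.
Qed.

Lemma conjugate_D_lt (x0 : X) (eps : R) : 0 < eps -> exists n, forall g g',
  (forall t, agree n (phi (f (psi t))) (g t)) ->
  (forall t, agree n (phi (finv (psi t))) (g' t)) ->
  D_lt d f finv (fun x => psi (g (phi x))) (fun x => psi (g' (phi x))) eps.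
Proof.
  intros He. destruct (psi_unif (eps / 2)) as [n Hn]; [lra|].
  exists n. intros g g' Hg Hg'.
  split; apply dC0_lt_intro with (eps / 2); auto; try lra; intros x; left; apply Hn;
    rewrite phi_psi.
  - specialize (Hg (phi x)). now rewrite psi_phi in Hg.
  - specialize (Hg' (phi x)). now rewrite psi_phi in Hg'.
Qed.

Lemma perturb_to_orbit (x0 : X) (eps : R) : 0 < eps -> exists delta, 0 < delta /\
  forall N (xs : nat -> X), (forall i, d (f (xs i)) (xs (S i)) <= delta) ->
    exists g ginv, is_homeo d g ginv /\ D_lt d f finv g ginv eps /\
      exists x, forall i, (i <= N)%nat -> d (xs i) (Nat.iter i g x) < eps.
Proof.
  intros He. destruct Hf as (Cf & Cf' & H1 & H2).
  destruct (conjugate_D_lt x0 eps He) as [n1 Hn1].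
  destruct (psi_unif eps He) as [n2 Hn2].
  destruct (realize_pseudo_orbit (fun t => phi (f (psi t))) (fun t => phi (finv (psi t)))
    (conjugate_buniform f Cf) (conjugate_buniform finv Cf')) with (n := max n1 n2)
    as [m Hm].
  { intros t. now rewrite psi_phi, H1. }
  { intros t. now rewrite psi_phi, H2. }
  destruct (phi_unif m) as (r & Hr & Hphi).
  (* Halving turns the non-strict bound on pseudo-orbits into a strict one. *)
  exists (r / 2). split; [lra|]. intros N xs Hxs.
  destruct (Hm N (fun i => phi (xs i))) as (g & g' & Hg & K1 & K2 & t & Ht).
  { intros i _. rewrite psi_phi. apply Hphi. specialize (Hxs i). lra. }
  exists (fun x => psi (g (phi x))), (fun x => psi (g' (phi x))). split; [|split].
  - now apply conjugate_homeo.
  - apply Hn1; intros s; [apply agree_le with (2 := K1 s)|apply agree_le with (2 := K2 s)];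
      lia.
  - exists (psi t). intros i Hi. rewrite conjugate_iter. apply Hn2.
    rewrite phi_psi. eapply agree_le; [|apply Ht; auto]. lia.
Qed.

Lemma perturb_to_finite_attractor (x0 : X) (eps : R) : 0 < eps ->
  exists g ginv, is_homeo d g ginv /\ D_lt d f finv g ginv eps /\
    exists P : list X, forall x eta, 0 < eta -> exists K, forall j, (K <= j)%nat ->
      exists p, In p P /\ d p (Nat.iter j g x) < eta.
Proof.
  intros He. destruct Hf as (Cf & Cf' & H1 & H2).
  destruct (conjugate_D_lt x0 eps He) as [n Hn].
  destruct (finite_attractor_perturbation (fun t => phi (f (psi t)))
    (fun t => phi (finv (psi t)))
    (conjugate_buniform f Cf) (conjugate_buniform finv Cf')) with (n := n)
    as (g & g' & Hg & K1 & K2 & P & HP).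
  { intros t. now rewrite psi_phi, H1. }
  { intros t. now rewrite psi_phi, H2. }
  exists (fun x => psi (g (phi x))), (fun x => psi (g' (phi x))). split; [|split].
  - now apply conjugate_homeo.
  - now apply Hn.
  - exists (map psi P). intros x eta Heta.
    destruct (psi_unif eta Heta) as [k Hk]. destruct (HP (phi x) k) as [K HK].
    exists K. intros j Hj. destruct (HK j Hj) as (p & Hp & Ha).
    exists (psi p). split; [now apply in_map|].
    rewrite <- (psi_phi x), conjugate_iter. apply Hk. now rewrite !phi_psi.
Qed.

End Perturbation.

(** * Shadowing and the non-wandering set *)

Lemma continuous_iter {X : Type} (d : X -> X -> R) (f : X -> X) (i : nat) :
  continuous d f -> continuous d (Nat.iter i f).
Proof.
  intros Hf. induction i as [|i IH]; intros x eps He; simpl.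
  - exists eps; auto.
  - destruct (Hf (Nat.iter i f x) eps He) as (r & Hr & H1).
    destruct (IH x r Hr) as (s & Hs & H2). exists s; auto.
Qed.

(** The points that shadow up to time [N] form nested nonempty closed sets. *)
Lemma shadowing_of_finite {X : Type} (d : X -> X -> R) (f : X -> X) :
  is_metric d -> compact d -> continuous d f ->
  (forall eps, 0 < eps -> exists delta, 0 < delta /\
    forall N (xs : nat -> X), (forall i, d (f (xs i)) (xs (S i)) <= delta) ->
      exists x, forall i, (i <= N)%nat -> d (xs i) (Nat.iter i f x) <= eps) ->
  shadowing d f.
Proof.
  intros Hd Hc Hf Hfin eps He. destruct (Hfin eps He) as (delta & Hdel & H).
  exists delta. split; auto. intros xs Hxs.
  destruct (nested_nonempty d Hc (fun N x => forall i, (i <= N)%nat ->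
    d (xs i) (Nat.iter i f x) <= eps)) as [x Hx].
  - intros N x Hx. apply not_all_ex_not in Hx as [i Hi].
    apply imply_to_and in Hi as [HiN Hi]. apply Rnot_le_lt in Hi.
    destruct (continuous_iter d f i Hf x (d (xs i) (Nat.iter i f x) - eps))
      as (r & Hr & Hy); [lra|].
    exists r. split; auto. intros y Hxy Hall. specialize (Hall i HiN).
    specialize (Hy y Hxy).
    pose proof (dist_tri d Hd (xs i) (Nat.iter i f y) (Nat.iter i f x)).
    rewrite (dist_sym d Hd (Nat.iter i f y)) in H0. lra.
  - intros N x Hx i Hi. apply Hx. lia.
  - intros N. now apply H.
  - exists x. intros i. apply (Hx i i). lia.
Qed.

Lemma semiconj_iter {X : Type} (f g h : X -> X) :
  (forall x, h (g x) = f (h x)) -> forall i x, h (Nat.iter i g x) = Nat.iter i f (h x).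
Proof. intros H i x. now apply Nat.iter_swap_gen. Qed.

Lemma list_continuity {X : Type} (d : X -> X -> R) (h : X -> X) (l : list X) (eps : R) :
  continuous d h -> 0 < eps -> exists delta, 0 < delta /\
    forall p y, In p l -> d p y < delta -> d (h p) (h y) < eps.
Proof.
  intros Hh He. induction l as [|p l (r & Hr & IH)].
  - exists 1. split; [lra|]. intros p y [].
  - destruct (Hh p eps He) as (s & Hs & Hp). exists (Rmin r s).
    split; [now apply Rmin_glb_lt|]. intros p' y [<-|Hin] Hy.
    + apply Hp. eapply Rlt_le_trans; [apply Hy|apply Rmin_r].
    + apply (IH p'); auto. eapply Rlt_le_trans; [apply Hy|apply Rmin_l].
Qed.

Lemma list_closed {X : Type} (d : X -> X -> R) (l : list X) (x : X) :
  is_metric d -> (forall eps, 0 < eps -> exists p, In p l /\ d p x < eps) -> In x l.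
Proof.
  intros Hd. induction l as [|p l IH]; intros H.
  - destruct (H 1) as (p & [] & _). lra.
  - destruct (excluded_middle_informative (p = x)) as [->|Hne]; [now left|].
    right. apply IH. intros eps He.
    destruct (H (Rmin eps (d p x))) as (p' & Hin & Hp').
    { apply Rmin_glb_lt; auto. now apply dist_pos. }
    pose proof (Rmin_l eps (d p x)). pose proof (Rmin_r eps (d p x)).
    destruct Hin as [<-|Hin]; [lra|]. exists p'. split; auto. lra.
Qed.

Lemma nonwandering_finite {X : Type} (d : X -> X -> R) (f g h : X -> X) (P : list X) :
  is_metric d -> shadowing d f -> continuous d h -> (forall y, exists x, h x = y) ->
  (forall x, h (g x) = f (h x)) ->
  (forall x eta, 0 < eta -> exists K, forall j, (K <= j)%nat ->
     exists p, In p P /\ d p (Nat.iter j g x) < eta) ->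
  finite_set (nonwandering d f).
Proof.
  intros Hd Hsh Ch Sh Hhg HP. exists (map h P). intros x Hx.
  apply (list_closed d); auto. intros eps He.
  destruct (Hsh (eps / 3)) as (delta & Hdel & Hs); [lra|].
  (* Two distances below [delta / 2] allow the jump from [f^n y] through [x] back to [y]; [eps / 3]
     is the share of [d x y] in the final estimate. *)
  set (r := Rmin (eps / 3) (delta / 2)).
  assert (Hr : 0 < r) by (apply Rmin_glb_lt; lra).
  assert (Hr1 : r <= eps / 3) by apply Rmin_l.
  assert (Hr2 : r <= delta / 2) by apply Rmin_r.
  destruct (Hx (fun y => d x y < r)) as (n & Hn & y & Hy & Hny).
  { now apply ball_open. }
  { now rewrite dist_refl. }
  (* The segment from [y] to [f^n y], closed up into a periodic pseudo-orbit. *)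
  destruct (Hs (fun i => Nat.iter (i mod n) f y)) as [z Hz].
  { intros i. change (f (Nat.iter (i mod n) f y)) with (Nat.iter (S (i mod n)) f y).
    pose proof (Nat.mod_upper_bound i n ltac:(lia)) as Hlt.
    pose proof (Nat.div_mod_eq i n) as Ei.
    destruct (Nat.eq_dec (S (i mod n)) n) as [E|E].
    - replace (S i mod n) with 0%nat.
      + rewrite E. simpl. pose proof (dist_tri d Hd (Nat.iter n f y) x y).
        rewrite (dist_sym d Hd (Nat.iter n f y) x) in H. lra.
      + symmetry. replace (S i) with (S (i / n) * n)%nat by nia.
        apply Nat.Div0.mod_mul.
    - replace (S i mod n) with (S (i mod n)).
      + rewrite dist_refl by auto. lra.
      + apply Nat.mod_unique with (i / n)%nat; lia. }
  destruct (Sh z) as [w <-].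
  destruct (list_continuity d h P (eps / 3) Ch) as (eta & Heta & Hl); [lra|].
  destruct (HP w eta Heta) as [K HK].
  (* At multiples of [n] the pseudo-orbit is back at [y], and [K * n] is late enough for the
     attraction to [P]. *)
  destruct (HK (K * n)%nat) as (p & Hp & Hpw); [nia|].
  exists (h p). split; [now apply in_map|].
  specialize (Hl p _ Hp Hpw). rewrite (semiconj_iter f g h Hhg) in Hl.
  specialize (Hz (K * n)%nat). rewrite Nat.Div0.mod_mul in Hz. simpl in Hz.
  rewrite (dist_sym d Hd y) in Hz.
  pose proof (dist_tri d Hd (h p) (Nat.iter (K * n) f (h w)) x).
  pose proof (dist_tri d Hd (Nat.iter (K * n) f (h w)) y x).
  rewrite (dist_sym d Hd y x) in H0. lra.
Qed.

Theorem theorem1p3 (X : Type) (d : X -> X -> R) (f finv : X -> X) :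
  cantor_space d -> is_homeo d f finv ->
  topologically_stable_strong d f finv ->
  shadowing d f /\ finite_set (nonwandering d f).
Proof.
  intros HX Hf Hst.
  (* The coding and the suprema require a base point, so the empty space is treated apart. *)
  destruct (excluded_middle_informative (exists x0 : X, True)) as [[x0 _]|Hempty].
  2: { split.
    - intros eps He. exists 1. split; [lra|]. intros xs _.
      exfalso. apply Hempty. now exists (xs 0%nat).
    - exists nil. intros x _. apply Hempty. now exists x. }
  pose proof HX as (Hd & Hc & Hp & Ht).
  destruct (cantor_coding d Hd Hc Ht Hp x0) as (phi & psi & E1 & E2 & U1 & U2).
  assert (Hsh : shadowing d f).
  { apply shadowing_of_finite; auto; [apply Hf|]. intros eps He.
    (* One half of [eps] is for the [g]-orbit near the pseudo-orbit, the other for [h] near the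
       identity. *)
    destruct (Hst (eps / 2)) as (e & Hpe & Hh); [lra|].
    destruct (perturb_to_orbit d f finv HX Hf phi psi E1 E2 U1 U2 x0 (Rmin e (eps / 2)))
      as (delta & Hdel & Hpert).
    { apply Rmin_glb_lt; lra. }
    exists delta. split; auto. intros N xs Hxs.
    destruct (Hpert N xs Hxs) as (g & ginv & Hg & [D1 D2] & x & Hx).
    destruct (Hh g ginv Hg) as (h & _ & _ & Hid & Hhg).
    { assert (Hle : forall u v, dC0_lt d u v (Rmin e (eps / 2)) -> dC0_lt d u v e).
      { intros u v (s & Hs & Hlt). exists s. split; auto.
        eapply Rlt_le_trans; [apply Hlt|apply Rmin_l]. }
      split; auto. }
    exists (h x). intros i Hi. specialize (Hx i Hi).
    rewrite <- (semiconj_iter f g h Hhg).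
    pose proof (dC0_lt_elim d _ _ _ Hid (Nat.iter i g x)) as Hi'. cbv beta in Hi'.
    pose proof (dist_tri d Hd (xs i) (Nat.iter i g x) (h (Nat.iter i g x))).
    rewrite (dist_sym d Hd (Nat.iter i g x)) in H.
    pose proof (Rmin_r e (eps / 2)). lra. }
  split; auto.
  destruct (Hst 1) as (e & Hpe & Hh); [lra|].
  destruct (perturb_to_finite_attractor d f finv HX Hf phi psi E1 E2 U1 U2 x0 e Hpe)
    as (g & ginv & Hg & HD & P & HP).
  destruct (Hh g ginv Hg HD) as (h & Ch & Sh & _ & Hhg).
  now apply (nonwandering_finite d f g h P).
Qed.
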